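(* Let $A$ and $B$ be groups, each of which is $n$-element order separable for every positive integer $n$. Suppose that $|a|\neq|b|$ for all $a\in A\setminus\{e\}$ and $b\in B\setminus\{e\}$ such that $|a|<\infty$ and $|b|<\infty$. Then the free product $G=A\ast B$ is $3$-element order separable.
   Context: Definition. A group $G$ is called $n$-element order separable if, for all elements $u_1,\dots,u_n$ of $G$ such that $u_i$ is conjugate in $G$ neither to $u_j$ nor to $u_j^{-1}$ whenever $i\neq j$, there exists a homomorphism of $G$ onto a finite group such that the orders of the images of $u_1,\dots,u_n$ are pairwise different. Here $|g|$ denotes the (possibly infinite) order of an element $g$, and $e$ denotes the identity element. *)

(* Defs.v *)
From HB Require Import structures.
From mathcomp Require Import all_boot all_fingroup cyclic.
From mathcomp Require Import boolp.

Set Implicit Arguments.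
Unset Strict Implicit.
Unset Printing Implicit Defensive.

Local Open Scope group_scope.

(* [None] encodes infinite order. *)
Definition gorder (G : groupType) (x : G) : option nat :=
  if pselect (exists n, (0 < n)%N && (x ^+ n == 1)) is left ex_n
  then Some (ex_minn ex_n) else None.

Definition conjugate (G : groupType) (x y : G) : Prop := exists g : G, x ^ g = y.

Definition order_separable (n : nat) (G : groupType) : Prop :=
  forall u : 'I_n -> G,
    (forall i j : 'I_n, i != j ->
       ~ conjugate (u i) (u j) /\ ~ conjugate (u i) (u j)^-1) ->
  exists (H : finGroupType) (f : UMagmaMorphism.type G H),
    (forall h : H, exists g : G, f g = h) /\
    (forall i j : 'I_n, i != j -> #[f (u i)] <> #[f (u j)]).

(* The free product is built from its normal forms: sequences of non-identity
   letters coming alternately from A and B.  [fp_lift] and the lemmas about it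
   are its universal property. *)
Section Words.
Variables A B : groupType.
Implicit Types (x y z : A + B) (s t w : seq (A + B)).

Definition letter1 x : bool :=
  match x with inl a => a == 1 | inr b => b == 1 end.

Definition letterV x : A + B :=
  match x with inl a => inl a^-1 | inr b => inr b^-1 end.

Definition letterM x y : option (A + B) :=
  match x, y with
  | inl a, inl a' => Some (inl (a * a'))
  | inr b, inr b' => Some (inr (b * b'))
  | _, _ => None
  end.

Definition alternates x y : bool := is_inl x != is_inl y.

Definition reduced w : bool := all (predC letter1) w && sorted alternates w.

(* The normal form of x :: w, for w reduced. *)
Definition push_letter x w : seq (A + B) :=
  if letter1 x then w else
  if w isn't y :: w' then [:: x] else
  if letterM x y isn't Some z then x :: w else
  if letter1 z then w' else z :: w'.

Definition word_mul s t : seq (A + B) := foldr push_letter t s.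

Definition word_inv w : seq (A + B) := rev (map letterV w).

Lemma reduced_cons x w :
  reduced (x :: w) =
  [&& ~~ letter1 x, (if w is y :: _ then alternates x y else true) & reduced w].
Proof.
rewrite /reduced /=; case: w => [|y w] /=; first by rewrite !andbT.
by case: (letter1 x); case: (alternates x y); rewrite //= ?andbF.
Qed.

Lemma reduced_push_letter x w : reduced w -> reduced (push_letter x w).
Proof.
rewrite /push_letter; case x1: (letter1 x) => //.
case: w => [|y w]; first by rewrite reduced_cons x1.
case xy: (letterM x y) => [z|] rw.
  case z1: (letter1 z); first by move: rw; rewrite reduced_cons => /and3P[].
  move: rw; rewrite !reduced_cons z1 => /and3P[_ yw ->]; rewrite andbT /=.
  by case: x y z w xy yw {x1 z1} => [a|b] [a'|b'] z [|c w] //= [<-].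
by rewrite reduced_cons x1 rw andbT /=; case: x y xy {x1 rw} => [a|b] [a'|b'].
Qed.

Lemma reduced_mul s t : reduced t -> reduced (word_mul s t).
Proof. by move=> rt; elim: s => //= x s IHs; apply: reduced_push_letter. Qed.

Lemma reduced_inv w : reduced w -> reduced (word_inv w).
Proof.
rewrite /reduced /word_inv all_rev all_map rev_sorted sorted_map => /andP[w1 sw].
apply/andP; split.
  by apply: sub_all w1 => -[a|b] /=; rewrite eq_invg1.
by move: sw; apply: sub_sorted => -[a|b] [a'|b'].
Qed.

Lemma push_letter1 x w : letter1 x -> push_letter x w = w.
Proof. by rewrite /push_letter => ->. Qed.

Lemma push_letter_reduced x w : reduced (x :: w) -> push_letter x w = x :: w.
Proof.
rewrite reduced_cons /push_letter => /and3P[/negbTE-> xw _].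
by case: w x xw => [|[a|b] w] [a'|b'].
Qed.

Definition head_alternates x w : bool := if w is y :: _ then alternates x y else true.

Definition cons_letter x w : seq (A + B) := if letter1 x then w else x :: w.

Lemma push_cons x y z w : letterM x y = Some z -> head_alternates x w ->
  push_letter x (cons_letter y w) = cons_letter z w.
Proof.
rewrite /push_letter /cons_letter.
case: x y => [a|b] [a'|b'] //= [<-] xw /=.
  have [->|a1] := eqVneq a 1; first by rewrite mul1g.
  have [->|//] := eqVneq a' 1; rewrite mulg1 (negbTE a1).
  by case: w xw => [|[c|c] w].
have [->|b1] := eqVneq b 1; first by rewrite mul1g.
have [->|//] := eqVneq b' 1; rewrite mulg1 (negbTE b1).
by case: w xw => [|[c|c] w].
Qed.

Lemma reduced_split x w : reduced w -> exists y w',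
  [/\ is_inl x = is_inl y, w = cons_letter y w' & head_alternates x w'].
Proof.
move=> rw; case: x => [a|b].
  case: w rw => [|[c|c] w] rw; last 1 first.
  - by exists (inl 1), (inr c :: w); rewrite /cons_letter /= eqxx.
  - by exists (inl 1), [::]; rewrite /cons_letter /= eqxx.
  exists (inl c), w; move: rw; rewrite reduced_cons /cons_letter /=.
  by case/and3P=> /negbTE-> ? _; split=> //; case: w.
case: w rw => [|[c|c] w] rw.
- by exists (inr 1), [::]; rewrite /cons_letter /= eqxx.
- by exists (inr 1), (inl c :: w); rewrite /cons_letter /= eqxx.
exists (inr c), w; move: rw; rewrite reduced_cons /cons_letter /=.
by case/and3P=> /negbTE-> ? _; split=> //; case: w.
Qed.

Lemma push_letterM x y z w : letterM x y = Some z -> reduced w ->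
  push_letter x (push_letter y w) = push_letter z w.
Proof.
move=> xy /(reduced_split x)[t [w' [xt -> xw']]].
case: x y z t xy xt xw' => [a|b] [a'|b'] //= _ [c|c] // [<-] _ xw.
  rewrite (@push_cons (inl a') _ (inl (a' * c))) //.
  rewrite (@push_cons (inl a) _ (inl (a * (a' * c)))) // mulgA.
  by rewrite (@push_cons (inl (a * a')) _ (inl (a * a' * c))).
rewrite (@push_cons (inr b') _ (inr (b' * c))) //.
rewrite (@push_cons (inr b) _ (inr (b * (b' * c)))) // mulgA.
by rewrite (@push_cons (inr (b * b')) _ (inr (b * b' * c))).
Qed.

Lemma word_mul_push x s t : reduced t ->
  word_mul (push_letter x s) t = push_letter x (word_mul s t).
Proof.
move=> rt; case x1: (letter1 x); first by rewrite !push_letter1.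
rewrite {1}/push_letter x1; case: s => //= y s.
case xy: (letterM x y) => [z|//].
rewrite (push_letterM xy (reduced_mul s rt)).
by case z1: (letter1 z); rewrite //= push_letter1.
Qed.

Lemma word_mulA s t w : reduced w ->
  word_mul s (word_mul t w) = word_mul (word_mul s t) w.
Proof. by move=> rw; elim: s => //= x s ->; rewrite word_mul_push. Qed.

Lemma word_mul1 w : reduced w -> word_mul w [::] = w.
Proof.
elim: w => //= x w IHw rxw; rewrite IHw ?push_letter_reduced //.
by move: rxw; rewrite reduced_cons => /and3P[].
Qed.

Lemma word_mulVw s t : reduced t -> word_mul (word_inv s) (word_mul s t) = t.
Proof.
elim: s t => //= x s IHs t rt.
rewrite /word_inv /= rev_cons /word_mul foldr_rcons -!/(word_mul _ _).
pose e : A + B := if x is inl _ then inl 1 else inr 1.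
have Ve : letterM (letterV x) x = Some e by rewrite /e; case: (x) => c /=; rewrite mulVg.
rewrite (push_letterM Ve) ?reduced_mul // push_letter1 ?IHs //.
by rewrite /e; case: (x) => c /=.
Qed.

Lemma word_invK : involutive word_inv.
Proof.
move=> w; rewrite /word_inv map_rev revK -map_comp map_id_in //.
by move=> -[a|b] _ /=; rewrite invgK.
Qed.

End Words.

#[global] Arguments push_letter : simpl never.

Record free_product (A B : groupType) :=
  FreeProduct { fp_word : seq (A + B); fp_wordP : reduced fp_word }.

HB.instance Definition _ A B := [isSub for @fp_word A B].
HB.instance Definition _ A B := [Choice of free_product A B by <:].

Section FreeProductGroup.
Variables A B : groupType.
Implicit Types u v w : free_product A B.

Definition fp_mul u v := FreeProduct (reduced_mul (fp_word u) (fp_wordP v)).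
Definition fp_inv u := FreeProduct (reduced_inv (fp_wordP u)).
Definition fp_one : free_product A B := @FreeProduct A B [::] isT.

Fact fp_mulA : associative fp_mul.
Proof. by move=> u v w; apply/val_inj/word_mulA/fp_wordP. Qed.

Fact fp_mul1 : left_id fp_one fp_mul.
Proof. by move=> u; apply/val_inj. Qed.

Fact fp_mulw1 : right_id fp_one fp_mul.
Proof. by move=> u; apply/val_inj/word_mul1/fp_wordP. Qed.

Fact fp_mulV : left_inverse fp_one fp_inv fp_mul.
Proof.
move=> u; apply/val_inj; rewrite /= -[in RHS](word_mulVw (fp_word u) (t := [::])) //.
by rewrite (word_mul1 (fp_wordP u)).
Qed.

Fact fp_mulwV : right_inverse fp_one fp_inv fp_mul.
Proof.
move=> u; have -> : fp_mul u (fp_inv u) = fp_mul (fp_inv (fp_inv u)) (fp_inv u).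
  by congr fp_mul; apply/val_inj; rewrite /= word_invK.
exact: fp_mulV.
Qed.

HB.instance Definition _ := isGroup.Build (free_product A B)
  fp_mulA fp_mul1 fp_mulw1 fp_mulV fp_mulwV.

Definition fp_letter (x : A + B) : free_product A B :=
  FreeProduct (reduced_push_letter x (w := [::]) isT).

Definition fp_inl (a : A) := fp_letter (inl a).
Definition fp_inr (b : B) := fp_letter (inr b).

Fact fp_inl1 : fp_inl 1 = 1.
Proof. by apply/val_inj; rewrite /= push_letter1 //= eqxx. Qed.

Fact fp_inl_morph : {morph fp_inl : a b / a * b}.
Proof.
move=> a b; apply/val_inj => /=.
rewrite word_mul_push; last exact: reduced_push_letter.
by rewrite /= (@push_letterM _ _ _ _ (inl (a * b))).
Qed.

Fact fp_inr1 : fp_inr 1 = 1.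
Proof. by apply/val_inj; rewrite /= push_letter1 //= eqxx. Qed.

Fact fp_inr_morph : {morph fp_inr : a b / a * b}.
Proof.
move=> a b; apply/val_inj => /=.
rewrite word_mul_push; last exact: reduced_push_letter.
by rewrite /= (@push_letterM _ _ _ _ (inr (a * b))).
Qed.

HB.instance Definition _ := isUMagmaMorphism.Build A (free_product A B) fp_inl
  (fp_inl1, fp_inl_morph).
HB.instance Definition _ := isUMagmaMorphism.Build B (free_product A B) fp_inr
  (fp_inr1, fp_inr_morph).

End FreeProductGroup.

Section UniversalProperty.
Variables (A B H : groupType).
Variables (f : UMagmaMorphism.type A H) (g : UMagmaMorphism.type B H).

Definition letter_lift (x : A + B) : H :=
  match x with inl a => f a | inr b => g b end.

Definition fp_lift (w : free_product A B) : H :=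
  foldr (fun x h => letter_lift x * h) 1 (fp_word w).

Let lift_word (w : seq (A + B)) : H := foldr (fun x h => letter_lift x * h) 1 w.

Let lift_push x w : lift_word (push_letter x w) = letter_lift x * lift_word w.
Proof.
rewrite /push_letter; case x1: (letter1 x).
  by case: x x1 => c /= /eqP->; rewrite gmulf1 mul1g.
case: w => [//|y w]; case xy: (letterM x y) => [z|//].
have <- : letter_lift z * lift_word w = letter_lift x * lift_word (y :: w).
  by case: x y xy {x1} => [a|b] [a'|b'] //= [<-] /=; rewrite gmulfM mulgA.
case z1: (letter1 z) => //.
by case: z z1 {xy} => c /= /eqP->; rewrite gmulf1 mul1g.
Qed.

Fact fp_lift_morph : {morph fp_lift : u v / u * v}.
Proof.
move=> u v; rewrite /fp_lift /= -!/(lift_word _).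
elim: (fp_word u) => [|x w IHw] /=; first by rewrite mul1g.
by rewrite lift_push IHw mulgA.
Qed.

HB.instance Definition _ :=
  isUMagmaMorphism.Build (free_product A B) H fp_lift (erefl, fp_lift_morph).

Lemma fp_lift_inl a : fp_lift (fp_inl B a) = f a.
Proof. by rewrite /fp_lift /= -/(lift_word _) lift_push /= mulg1. Qed.

Lemma fp_lift_inr b : fp_lift (fp_inr A b) = g b.
Proof. by rewrite /fp_lift /= -/(lift_word _) lift_push /= mulg1. Qed.

Lemma fp_lift_unique (h : UMagmaMorphism.type (free_product A B) H) :
  (forall a, h (fp_inl B a) = f a) -> (forall b, h (fp_inr A b) = g b) ->
  h =1 fp_lift.
Proof.
move=> hf hg [w rw]; rewrite /fp_lift /=.
elim: w rw => [|x w IHw] rw /=.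
  have -> : FreeProduct rw = 1 by apply/val_inj.
  exact: gmulf1.
have rw' : reduced w by move: rw; rewrite reduced_cons => /and3P[].
rewrite -(IHw rw').
have -> : FreeProduct rw = fp_letter x * FreeProduct rw'.
  by apply/val_inj; rewrite /= word_mul_push //= push_letter_reduced.
by rewrite gmulfM; case: (x) => c; rewrite /= -?hf -?hg.
Qed.

End UniversalProperty.

Lemma gorderP (G : groupType) (x : G) (n : nat) :
  gorder x = Some n <->
  [/\ (0 < n)%N, x ^+ n = 1 & forall m, (0 < m < n)%N -> x ^+ m <> 1].
Proof.
rewrite /gorder; case: pselect => [ex_n|nex]; last first.
  by split=> // -[n0 xn _]; case: nex; exists n; rewrite n0 xn eqxx.
case: ex_minnP => k /andP[k0 /eqP xk] min_k; split=> [[<-]|[n0 xn min_n]].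
  split=> // m /andP[m0 mk] xm.
  by have := min_k m; rewrite m0 xm eqxx leqNgt mk => /(_ isT).
congr Some; apply/eqP; rewrite eqn_leq min_k ?n0 ?xn ?eqxx // leqNgt.
by apply/negP=> kn; apply: (min_n k); rewrite ?k0.
Qed.

Lemma gorder_fin (G : finGroupType) (x : G) : gorder x = Some #[x].
Proof.
apply/gorderP; split=> [||m /andP[m0 mx] /eqP]; rewrite ?order_gt0 ?expg_order //.
by rewrite -order_dvdn => /(dvdn_leq m0); rewrite leqNgt mx.
Qed.

(* Main.v *)
(* Up to conjugation and inversion an element of A * B is a letter or a power
   r^k, k > 0, of a cyclically alternating word r = a_1 b_1 ... a_n b_n of minimal
   length.  Letters are separated by suitable finite images of A and B, and
   letting these images act on truncated normal forms gives a finite quotient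
   q : A * B -> Q with the same orders of letters, which moreover keeps any given
   finite set of nontrivial elements away from 1.

   Given a labelling of Q by elements of a finite group U, let A act on Q x U by
   translations of the first coordinate, and B by such translations conjugated
   by (x, u) |-> (x, u label(x)).  The orders of letters do not change, while the
   order of a word is multiplied by the order of its holonomy.  If no proper
   prefix of r commutes with r in Q, then the closed path of r in Q meets the
   powers of r only once each, and the label 1 in Z/K at one point makes the order
   of r a multiple of K.  If r and s are not conjugate up to inversion, then for
   suitable Q each translate of the closed path of s avoids a power of r.  Put the
   elementary matrices 1 + E_(t,t+1), t < p, at such powers of r: the holonomy of r
   is then a full unipotent Jordan block of size p + 1, of order p^2, whereas along
   the translates of s some superdiagonal entry always vanishes, so that the
   order of the holonomy divides p.  Different large primes p for the different
   pairs allow these quotients to be combined. *)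
Require Import Defs.
From mathcomp Require Import all_boot all_fingroup.
From HB Require Import structures.
From mathcomp Require Import all_algebra cyclic.
From mathcomp Require Import boolp zify.

Set Implicit Arguments.
Unset Strict Implicit.
Unset Printing Implicit Defensive.
Import GRing.Theory.

(** * Commuting words in a free monoid *)

Section FreeMonoid.
Variable T : eqType.
Implicit Types u v z : seq T.

Definition rep n z := flatten (nseq n z).

Lemma repD m n z : rep (m + n) z = rep m z ++ rep n z.
Proof. by rewrite /rep nseqD flatten_cat. Qed.

Lemma size_rep n z : size (rep n z) = n * size z.
Proof. by elim: n => //= n IHn; rewrite size_cat IHn mulSn. Qed.

Lemma rep1 z : rep 1 z = z.
Proof. exact: cats0. Qed.

(** Euclid's algorithm on lengths: the shorter word is a prefix of the longer one, and removing it
    leaves a commuting pair of smaller total length. *)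
Lemma commuting_words u v : u ++ v = v ++ u ->
  exists z i j, u = rep i z /\ v = rep j z.
Proof.
move: {2}(size u + size v) (leqnn (size u + size v)) => n.
elim: n u v => [|n IHn] u v.
  by case: u v => [|x u] [|y v] //= _ _; exists [::], 0%N, 0%N.
wlog uv : u v / size u <= size v => [th_sym|] un.
  case: (leqP (size u) (size v)) => [/th_sym|/ltnW vu]; first exact.
  by rewrite addnC in un => /esym/(th_sym _ _ vu un)[z [i [j [? ?]]]]; exists z, j, i.
case: (eqVneq u [::]) => [-> _|u0]; first by exists v, 0%N, 1%N; rewrite rep1.
move=> e; have vE : v = u ++ drop (size u) v.
  rewrite -{1}(cat_take_drop (size u) v); congr (_ ++ _).
  by have /(congr1 (take (size u))) := e; rewrite take_size_cat // takel_cat.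
move: un e; rewrite vE => {vE uv}; set w := drop _ _ => un.
rewrite -[in RHS]catA => /eqP; rewrite eqseq_cat // eqxx /= => /eqP uw.
have [|z [i [j [-> wE]]]] := IHn u w _ uw.
  have : 0 < size u by rewrite lt0n size_eq0.
  by move: un; rewrite size_cat; lia.
by exists z, i, (i + j); rewrite repD -wE.
Qed.

Lemma commuting_rep n u v : v ++ u = u ++ v -> v ++ rep n u = rep n u ++ v.
Proof.
move=> vu; elim: n => [|n IHn]; first by rewrite cats0.
by rewrite /rep /= -!/(rep n u) -catA -IHn !catA vu.
Qed.

(** Both [u ++ v] and [v ++ u] commute with every power of [x], so both are the initial segment of
    the same length of a long enough power of [x]. *)
Lemma commuting_trans x u v : x != [::] -> u ++ x = x ++ u -> v ++ x = x ++ v ->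
  u ++ v = v ++ u.
Proof.
move=> x0 ux vx; pose n := size (u ++ v); pose t := rep n x.
have nt : n <= size t by rewrite size_rep leq_pmulr // lt0n size_eq0.
have uvt : take n t = u ++ v.
  have : (u ++ v) ++ t = t ++ (u ++ v).
    by rewrite -catA (commuting_rep n vx) !catA (commuting_rep n ux).
  by move/(congr1 (take n)); rewrite take_size_cat // takel_cat.
have : (v ++ u) ++ t = t ++ (v ++ u).
  by rewrite -catA (commuting_rep n ux) !catA (commuting_rep n vx).
move/(congr1 (take n)); rewrite [in RHS]takel_cat // uvt take_size_cat //.
by rewrite /n !size_cat addnC.
Qed.

End FreeMonoid.

(** * Unitriangular matrices in characteristic p *)

Section Unitriangular.
Local Open Scope ring_scope.
Variable p : nat.
Hypothesis p_pr : prime p.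
Local Notation F := 'F_p.
Local Notation M := 'M[F]_p.+1.
Implicit Types X Y : M.

(** Filtration by diagonals: level 1 means strictly upper triangular, levels add under products, and
    a level beyond [p] leaves only the zero matrix. *)
Definition supported_above k X := forall i j : 'I_p.+1, (j < i + k)%N -> X i j = 0.

Definition superdiag X (t : 'I_p) : F := X (inord t) (inord t.+1).

Lemma supported_aboveM k l X Y : supported_above k X -> supported_above l Y ->
  supported_above (k + l) (X * Y).
Proof.
move=> hX hY i j ij; rewrite mxE big1 // => t _.
have [ti|it] := ltnP t (i + k); first by rewrite hX // mul0r.
by rewrite hY ?mulr0 //; lia.
Qed.

Lemma supported_aboveD k X Y :
  supported_above k X -> supported_above k Y -> supported_above k (X + Y).
Proof. by move=> hX hY i j ij; rewrite mxE hX ?hY ?addr0. Qed.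

Lemma supported_aboveW k l X : (l <= k)%N ->
  supported_above k X -> supported_above l X.
Proof. by move=> lk hX i j ij; apply: hX; lia. Qed.

Lemma supported_aboveX X n : supported_above 1 X -> supported_above n (X ^+ n).
Proof.
move=> hX; elim: n => [|n IHn].
  move=> i j; rewrite addn0 => ji; rewrite expr0 mxE.
  by case: eqVneq ji => // ->; rewrite ltnn.
by rewrite exprS -add1n; apply: supported_aboveM.
Qed.

Lemma supported_above0 k X : (p < k)%N -> supported_above k X -> X = 0.
Proof. by move=> pk hX; apply/matrixP=> i j; rewrite mxE hX //; have := ltn_ord j; lia. Qed.

(** Each factor raises the index by at least one, so [n] steps lead from 0 to [n] only through 0, 1,
    ..., n. *)
Lemma nilpotentX_corner X n : supported_above 1 X -> (n <= p)%N ->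
  (X ^+ n) ord0 (inord n) = \prod_(t < p | (t < n)%N) superdiag X t.
Proof.
move=> hX; elim: n => [|n IHn] np.
  rewrite big_pred0 // expr0 mxE.
  suff -> : inord 0 = ord0 :> 'I_p.+1 by rewrite eqxx.
  by apply: val_inj; rewrite /= inordK.
have hXn := supported_aboveX (n := n) hX.
rewrite exprSr mxE (bigD1 (inord n)) //= big1 => [|t tn].
  rewrite addr0 IHn ?(ltnW np) //.
  rewrite [RHS](bigD1 (Ordinal np)) //= [RHS]mulrC; congr (_ * _).
  apply: eq_bigl => t; rewrite -(inj_eq val_inj) /=; lia.
have [tn'|nt] := ltnP t n; first by rewrite hXn ?mul0r // add0n.
rewrite hX ?mulr0 // inordK ?ltnS // addn1 ltnS ltn_neqAle nt andbT.
apply: contra tn => /eqP tn; apply/eqP/val_inj; by rewrite /= inordK // ltnW.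
Qed.

(** In size [p + 1] a matrix of level [p] can be nonzero only in its upper right corner, which is
    here the product of all superdiagonal entries. *)
Lemma nilpotentX_eq0 X : supported_above 1 X ->
  (X ^+ p == 0) = [exists t, superdiag X t == 0].
Proof.
move=> hX; have := nilpotentX_corner hX (leqnn p).
rewrite (eq_bigl predT) => [|t]; last exact: ltn_ord.
move=> e; apply/eqP/idP=> [X0|/existsP[t /eqP t0]].
  move: e; rewrite X0 mxE => /esym/eqP/prodf_eq0[t _ t0].
  by apply/existsP; exists t.
apply/matrixP=> i j; rewrite mxE.
have [ij|ij] := ltnP j (i + p); first exact: supported_aboveX.
have -> : i = ord0 by apply: val_inj => /=; have := ltn_ord j; lia.
have -> : j = inord p.
  by apply: val_inj; rewrite /= inordK //; have := ltn_ord j; lia.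
by rewrite e (bigD1 t) //= t0 mul0r.
Qed.

(** Frobenius is additive on the commuting elements 1 and [X - 1]. *)
Lemma unipotentX X : X ^+ p = 1 + (X - 1) ^+ p.
Proof.
have pM : p \in [pchar M] by rewrite pchar_lalg pchar_Fp.
have := pFrobenius_autD_comm pM (x := 1) (y := X - 1).
rewrite !pFrobenius_autE (addrC 1) subrK expr1n => -> //.
exact: commr_sym (commr1 _).
Qed.

Definition unitriangular X := supported_above 1 (X - 1).

Lemma unitriangular_sub1M X Y :
  X * Y - 1 = (X - 1) + (Y - 1) + (X - 1) * (Y - 1).
Proof.
  rewrite -{1}(subrK 1 X) -{1}(subrK 1 Y); move: (X - 1) (Y - 1) => U V.
  rewrite mulrDl !mulrDr !mulr1 !mul1r addrA addrK.
  by rewrite -addrA addrC.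
Qed.

Lemma unitriangularM X Y :
  unitriangular X -> unitriangular Y -> unitriangular (X * Y).
Proof.
move=> hX hY; rewrite /unitriangular unitriangular_sub1M.
do 2?apply: supported_aboveD => //.
by apply: (@supported_aboveW 2) => //; apply: (@supported_aboveM 1 1).
Qed.

Lemma unitriangular1 : unitriangular 1.
Proof. by move=> i j _; rewrite subrr mxE. Qed.

Lemma superdiag_sub1 X t : superdiag (X - 1) t = superdiag X t.
Proof.
rewrite /superdiag !mxE; case: eqP => [/(congr1 val)/=|_]; last by rewrite subr0.
by have tp := ltn_ord t; rewrite !inordK ?ltnS ?(ltnW tp) // => e; exfalso; lia.
Qed.

(** The cross term [(X - 1) * (Y - 1)] has level 2 and misses the superdiagonal. *)
Lemma superdiagM X Y t : unitriangular X -> unitriangular Y ->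
  superdiag (X * Y) t = superdiag X t + superdiag Y t.
Proof.
move=> hX hY; rewrite -superdiag_sub1 unitriangular_sub1M.
have hXY : supported_above 2 ((X - 1) * (Y - 1)) by exact: (@supported_aboveM 1 1).
rewrite -(superdiag_sub1 X) -(superdiag_sub1 Y) /superdiag mxE [X in _ + X]hXY.
  by rewrite addr0 mxE.
by have tp := ltn_ord t; rewrite !inordK ?ltnS ?(ltnW tp) //; lia.
Qed.

Lemma unitriangular_period X : unitriangular X -> X ^+ (p ^ 2) = 1.
Proof.
move=> hX; have p1 := prime_gt1 p_pr.
rewrite expnS expn1 exprM unipotentX (unipotentX X) (addrC 1 ((X - 1) ^+ p)) addrK.
rewrite -exprM (supported_above0 _ (supported_aboveX (n := p * p) hX)) ?addr0 //.
by nia.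
Qed.

Lemma unitriangular_unit X : unitriangular X -> X \is a GRing.unit.
Proof.
move=> /unitriangular_period; have := prime_gt0 p_pr.
case: (p ^ 2)%N (expn_gt0 p 2) => [|m] /=; first by move=> + p0; rewrite p0.
move=> _ _ Xm; apply/unitrP; exists (X ^+ m).
by rewrite -exprS -exprSr Xm.
Qed.

Definition unitriangular_set : {set {unit M}} :=
  [set u | `[< unitriangular (FinRing.uval u) >]].

Lemma unitriangular_set_group : group_set unitriangular_set.
Proof.
apply/group_setP; split=> [|u v]; rewrite !inE.
  by apply/asboolP; exact: unitriangular1.
by move=> /asboolP hu /asboolP hv; apply/asboolP; exact: unitriangularM.
Qed.

(** All that the covers use about unitriangular matrices: superdiagonal entries are characters with
    freely prescribable values, and the vanishing of one of them decides whether the order divides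
    [p]. *)
Lemma unitriangular_group : exists (U : finGroupType) (chi : 'I_p -> U -> F),
  [/\ forall t, {morph chi t : u v / (u * v)%g >-> u + v},
      forall u : U, (u ^+ p == 1)%g = [exists t, chi t u == 0],
      forall u : U, (u ^+ (p ^ 2)%N = 1)%g
    & forall s : 'I_p -> F, exists u, forall t, chi t u = s t].
Proof.
pose V := Group unitriangular_set_group; pose m (u : subg_of V) : M := FinRing.uval (sgval u).
have m_ut u : unitriangular (m u).
  by have := subgP u; rewrite inE => /asboolP.
have mM u v : m (u * v)%g = m u * m v by [].
have mX u n : m (u ^+ n)%g = m u ^+ n.
  by elim: n => // n IHn; rewrite expgS exprS mM IHn.
have m_eq1 u : (u == 1)%g = (m u == 1).
  by rewrite -(inj_eq val_inj) -(inj_eq val_inj).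
exists (subg_of V), (fun t u => superdiag (m u) t); split=> [t u v|u|u|s].
- by rewrite mM superdiagM.
- rewrite m_eq1 mX unipotentX addrC -subr_eq0 addrK nilpotentX_eq0; last exact: m_ut.
  by apply: eq_existsb => t; rewrite superdiag_sub1.
- by apply/eqP; rewrite m_eq1 mX unitriangular_period.
(* The default 0 of [oapp] is never reached: [j = i + 1] forces [i < p]. *)
pose N : M := \matrix_(i, j) if (j == i.+1 :> nat) then oapp s 0 (insub (i : nat)) else 0.
have N_ut : unitriangular (1 + N).
  move=> i j ij; rewrite addrC addKr mxE; case: eqP => // ji; lia.
pose u := FinRing.unit M (unitriangular_unit N_ut).
have uV : u \in V by rewrite inE; apply/asboolP.
exists (subg V u) => t; rewrite /m subgK // -superdiag_sub1 /= addrC addKr.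
have tp := ltn_ord t; rewrite /superdiag mxE !inordK ?ltnS ?(ltnW tp) // eqxx.
by rewrite (insubT (fun i => i < p)%N tp) /=; congr s; apply: val_inj.
Qed.

End Unitriangular.

Local Open Scope group_scope.

(** * Orders in finite quotients *)

Lemma morph1 (G H : groupType) (f : G -> H) :
  {morph f : x y / x * y} -> f 1 = 1.
Proof. by move=> fM; apply: (mulIg (f 1)); rewrite -fM !mul1g. Qed.

Definition mkhom (G H : groupType) (f : G -> H) (fM : {morph f : x y / x * y}) :
    UMagmaMorphism.type G H :=
  HB.pack f (isUMagmaMorphism.Build G H f (morph1 fM, fM)).

Lemma mkhomE (G H : groupType) (f : G -> H) fM x : @mkhom G H f fM x = f x.
Proof. by []. Qed.

(** * Conjugacy up to inversion *)

Section Sim.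
Variable G : groupType.
Implicit Types x y z : G.

Definition sim x y := Defs.conjugate x y \/ Defs.conjugate x y^-1.

Lemma conjugate_sym x y : Defs.conjugate x y -> Defs.conjugate y x.
Proof. by case=> g <-; exists g^-1; rewrite conjgK. Qed.

Lemma conjugate_trans x y z : Defs.conjugate x y -> Defs.conjugate y z -> Defs.conjugate x z.
Proof. by case=> g <- [h <-]; exists (g * h); rewrite conjgM. Qed.

Lemma conjugateV x y : Defs.conjugate x y -> Defs.conjugate x^-1 y^-1.
Proof. by case=> g <-; exists g; rewrite conjVg. Qed.

Lemma sim_refl x : sim x x.
Proof. by left; exists 1; rewrite conjg1. Qed.

Lemma sim_sym x y : sim x y -> sim y x.
Proof.
case=> /conjugate_sym; first by left.
by move=> /conjugateV; rewrite invgK; right.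
Qed.

Lemma sim_trans x y z : sim x y -> sim y z -> sim x z.
Proof.
move=> [xy|xy] [yz|yz].
- by left; apply: conjugate_trans yz.
- by right; apply: conjugate_trans yz.
- by right; apply: conjugate_trans xy _; apply: conjugateV.
- by left; apply: conjugate_trans xy _; rewrite -[z]invgK; apply: conjugateV.
Qed.

Lemma sim_conj x g : sim x (x ^ g).
Proof. by left; exists g. Qed.

Lemma sim_inv x : sim x x^-1.
Proof. by right; exists 1; rewrite invgK conjg1. Qed.

Lemma simX x y n : sim x y -> sim (x ^+ n) (y ^+ n).
Proof.
case=> -[g e]; [left|right]; exists g; first by rewrite conjXg e.
by rewrite conjXg e expgVn.
Qed.

Lemma sim1 x : sim x 1 -> x = 1.
Proof. by case=> -[g] /eqP; rewrite ?invg1 conjg_eq1 => /eqP. Qed.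

End Sim.

Lemma sim_hom (G H : groupType) (f : UMagmaMorphism.type G H) x y :
  sim x y -> sim (f x) (f y).
Proof. by case=> -[g e]; [left|right]; exists (f g); rewrite -gmulfJ e ?gmulfV. Qed.

Lemma sim_order (H : finGroupType) (x y : H) : sim x y -> #[x] = #[y].
Proof. by case=> -[g e]; [rewrite -e|rewrite -[RHS]orderV -e]; rewrite orderJ. Qed.

Lemma sim_order_hom (G : groupType) (H : finGroupType)
  (f : UMagmaMorphism.type G H) x y : sim x y -> #[f x] = #[f y].
Proof. by move=> /(sim_hom f)/sim_order. Qed.

(** Keeping only the order function of a finite quotient lets quotients be combined by least common
    multiples. Surjectivity is restored by [realized_onto]. *)
Definition realized (G : groupType) (w : G -> nat) : Prop :=
  exists (H : finGroupType) (f : UMagmaMorphism.type G H), forall x, #[f x] = w x.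

Lemma order_pair (H K : finGroupType) (x : H) (y : K) :
  #[(x, y)] = lcmn #[x] #[y].
Proof.
have pairX n : (x, y) ^+ n = (x ^+ n, y ^+ n) :> H * K.
  by elim: n => [|n IHn]; rewrite ?expg0 // !expgS IHn.
apply/eqP; rewrite eqn_dvd order_dvdn pairX.
rewrite (eqP (_ : x ^+ _ == 1)) -?order_dvdn ?dvdn_lcml //.
rewrite (eqP (_ : y ^+ _ == 1)) -?order_dvdn ?dvdn_lcmr // eqxx dvdn_lcm.
have /eqP := expg_order (x, y); rewrite pairX => /andP[/=].
by rewrite -!order_dvdn => -> ->.
Qed.

Lemma realized_lcm (G : groupType) (v w : G -> nat) :
  realized v -> realized w -> realized (fun x => lcmn (v x) (w x)).
Proof.
move=> [H [f fv]] [K [g gw]]; pose h x := (f x, g x).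
have hM : {morph h : x y / x * y} by move=> x y; rewrite /h !gmulfM.
by exists (H * K)%type, (mkhom hM) => x; rewrite mkhomE order_pair fv gw.
Qed.

Lemma realized_onto (G : groupType) (w : G -> nat) : realized w ->
  exists (H : finGroupType) (f : UMagmaMorphism.type G H),
    (forall h : H, exists g, f g = h) /\ forall x, #[f x] = w x.
Proof.
move=> [H [f fw]]; pose S : {set H} := [set h | `[< exists g, f g = h >]].
have memS g : f g \in S by rewrite inE; apply/asboolP; exists g.
have gS : group_set S.
  have f1 : f 1 = 1 := gmulf1.
  apply/group_setP; split; first by rewrite -f1 memS.
  move=> x y; rewrite !inE => /asboolP[g <-] /asboolP[h <-].
  by apply/asboolP; exists (g * h); rewrite gmulfM.
pose K := Group gS; pose k x := subg K (f x).
have kK x : sgval (k x) = f x by rewrite subgK.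
have kM : {morph k : x y / x * y}.
  by move=> x y; apply: val_inj; rewrite /= -!/(sgval _) kK gmulfM !subgK.
exists (subg_of K), (mkhom kM); split=> [h|x].
  have := subgP h; rewrite inE => /asboolP[g gh]; exists g.
  by apply: val_inj; rewrite /= -!/(sgval _) kK.
rewrite mkhomE -fw -(kK x); apply/eqP; rewrite eqn_dvd !order_dvdn.
have valX n (y : subg_of K) : sgval (y ^+ n) = sgval y ^+ n.
  by elim: n => // n IHn; rewrite !expgS -IHn.
rewrite -valX expg_order eqxx -(inj_eq val_inj) /= -!/(sgval _).
by rewrite valX expg_order eqxx.
Qed.

(** * Separation of orders in the factors *)

(** Order separability speaks of pairwise inequivalent elements, while a list may repeat a class;
    hence the choice of one element per class. *)
Lemma sim_representatives (G : groupType) (L : seq G) : exists R : seq G,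
  (forall i j, i < size R -> j < size R -> i != j ->
     ~ sim (nth 1 R i) (nth 1 R j)) /\
  (forall x, x \in L -> exists2 i, i < size R & sim x (nth 1 R i)).
Proof.
elim: L => [|x L [R [Rnsim RL]]]; first by exists [::]; split.
have [[i iR xi]|nx] := pselect (exists2 i, i < size R & sim x (nth 1 R i)).
  exists R; split=> // y; rewrite inE => /predU1P[->|/RL//].
  by exists i.
exists (x :: R); split=> [i j|y].
  case: i j => [|i] [|j] //= iR jR; rewrite ?eqSS => ij.
  - by move=> xj; apply: nx; exists j.
  - by move/sim_sym => xj; apply: nx; exists i.
  - exact: Rnsim.
rewrite inE => /predU1P[->|/RL[i iR yi]]; first by exists 0; last exact: sim_refl.
by exists i.+1.
Qed.

Lemma realized1 (G : groupType) : realized (fun _ : G => 1%N).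
Proof. by exists {perm bool}, (@one_fun G {perm bool}) => x; rewrite order1. Qed.

Lemma realized_sim (G : groupType) (w : G -> nat) x y :
  realized w -> sim x y -> w x = w y.
Proof. by move=> [H [f fw]] xy; rewrite -!fw; apply: sim_order_hom. Qed.

Lemma realized_eq1 (G : groupType) (w : G -> nat) : realized w -> w 1 = 1%N.
Proof. by move=> [H [f <-]]; rewrite gmulf1 order1. Qed.

Lemma realized_dvd (G : groupType) (w : G -> nat) x n :
  realized w -> (w x %| n) = (w (x ^+ n) == 1%N).
Proof. by move=> [H [f fw]]; rewrite -!fw gmulfXn order_dvdn order_eq1. Qed.

Lemma realized_gt0 (G : groupType) (w : G -> nat) x : realized w -> 0 < w x.
Proof. by move=> [H [f <-]]. Qed.

Section OneFactor.
Variable A : groupType.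
Hypothesis sepA : forall n, (0 < n)%N -> order_separable n A.

Lemma separate_seq (L : seq A) : exists2 w : A -> nat, realized w &
  forall x y, x \in L -> y \in L -> ~ sim x y -> w x <> w y.
Proof.
(* Adding 1 makes the family of representatives nonempty, as [sepA] demands. *)
have [R [Rnsim RL]] := sim_representatives (1 :: L).
have [i0 i0R _] := RL 1 (mem_head _ _).
have [|H [f [_ fR]]] := sepA (leq_trans (ltn0Sn i0) i0R)
  (u := fun i => nth 1 R i).
  by move=> i j ij; split=> ?; apply: (Rnsim i j) => //; [left|right].
exists (fun x => #[f x]) => [|x y xL yL nxy]; first by exists H, f.
have [i iR xi] : exists2 i, i < size R & sim x (nth 1 R i).
  by apply: RL; rewrite inE xL orbT.
have [j jR yj] : exists2 i, i < size R & sim y (nth 1 R i).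
  by apply: RL; rewrite inE yL orbT.
rewrite (sim_order_hom f xi) (sim_order_hom f yj).
apply: (fR (Ordinal iR) (Ordinal jR)); apply/negP=> /eqP[ij].
by apply: nxy; apply: sim_trans xi _; rewrite ij; apply: sim_sym.
Qed.

Lemma residually_finite_seq (L : seq A) : exists2 w : A -> nat, realized w &
  forall x, x \in L -> x <> 1 -> w x <> 1%N.
Proof.
have [w rw wL] := separate_seq (1 :: L); exists w => // x xL x1.
rewrite -(realized_eq1 rw); apply: wL; rewrite ?mem_head ?inE ?xL ?orbT //.
by move/sim1.
Qed.

(** It suffices to keep finitely many powers of [a] away from 1: those below the order of [a] if it
    is finite, the first [N] otherwise. *)
Lemma control_order (L : seq A) (a : A) (N : nat) : exists2 w : A -> nat,
  realized w & (forall x, x \in L -> x <> 1 -> w x <> 1%N) /\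
  (if gorder a is Some k then w a = k else (N < w a)%N).
Proof.
case ga: (gorder a) => [k|].
  have [k0 ak ka] := (gorderP a k).1 ga.
  have [w rw wL] := residually_finite_seq ([seq a ^+ i | i <- iota 1 k] ++ L).
  exists w => //; split=> [x xL|]; first by apply: wL; rewrite mem_cat xL orbT.
  have wk : w a %| k by rewrite realized_dvd // ak realized_eq1.
  have w0 := realized_gt0 a rw.
  apply/eqP; rewrite eqn_leq dvdn_leq //= leqNgt; apply/negP=> lt_k.
  apply: (wL (a ^+ w a)); last by apply/eqP; rewrite -realized_dvd.
    by rewrite mem_cat map_f // mem_iota w0 /= add1n ltnS ltnW.
  by apply: ka; rewrite w0.
have na i : (0 < i)%N -> a ^+ i <> 1.
  move=> i0 ai; move: ga; rewrite /gorder; case: pselect => // -[].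
  by exists i; rewrite i0 ai eqxx.
have [w rw wL] := residually_finite_seq ([seq a ^+ i | i <- iota 1 N] ++ L).
exists w => //; split=> [x xL|]; first by apply: wL; rewrite mem_cat xL orbT.
have w0 := realized_gt0 a rw; rewrite ltnNge; apply/negP=> leN.
apply: (wL (a ^+ w a)); last by apply/eqP; rewrite -realized_dvd.
  by rewrite mem_cat map_f // mem_iota w0 /= add1n ltnS.
exact: na.
Qed.

End OneFactor.

Section TwoFactors.
Variables A B : groupType.
Hypothesis sepA : forall n, (0 < n)%N -> order_separable n A.
Hypothesis sepB : forall n, (0 < n)%N -> order_separable n B.
Hypothesis orderAB : forall (a : A) (b : B), a <> 1 -> b <> 1 ->
     gorder a <> None -> gorder b <> None -> gorder a <> gorder b.

(** Finite orders are kept exactly and differ by [orderAB], while an element of infinite order is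
    given an order above the one on the other side. If one element is trivial, the other only has to
    survive. *)
Lemma separate_factors (a : A) (b : B) (L : seq A) (M : seq B) :
  a <> 1 \/ b <> 1 ->
  exists (v : A -> nat) (w : B -> nat), [/\ realized v, realized w,
    forall x, x \in L -> x <> 1 -> v x <> 1%N,
    forall y, y \in M -> y <> 1 -> w y <> 1%N & v a <> w b].
Proof.
move=> ab; have [a1|/eqP a1] := eqVneq a 1; last have [b1|/eqP b1] := eqVneq b 1.
- have [v rv vL] := residually_finite_seq sepA L.
  have [w rw wM] := residually_finite_seq sepB (b :: M).
  exists v, w; split=> // [y yM|]; first by apply: wM; rewrite inE yM orbT.
  rewrite a1 realized_eq1 // => /esym; apply: wM; rewrite ?mem_head //.
  by case: ab.
- have [v rv vL] := residually_finite_seq sepA (a :: L).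
  have [w rw wM] := residually_finite_seq sepB M.
  exists v, w; split=> // [x xL|]; first by apply: vL; rewrite inE xL orbT.
  by rewrite b1 realized_eq1 //; apply: vL; rewrite ?mem_head.
(* [w0] is fixed before [v], for the case of infinite order of [a]; [w] is chosen after [v], for the
   case of finite order. *)
have [w0 rw0 [w0M w0b]] := control_order sepB M b 0.
have [v rv [vL va]] := control_order sepA L a (w0 b).
have [w rw [wM wb]] := control_order sepB M b (v a).
case ga: (gorder a) va => [k|] va.
  exists v, w; split=> //; case gb: (gorder b) wb => [l|] wb.
    rewrite va wb => kl; apply: (orderAB a1 b1); rewrite ?ga ?gb ?kl //.
  by move=> e; move: wb; rewrite e ltnn.
by exists v, w0; split=> // e; move: va; rewrite e ltnn.
Qed.

(** If [a] and [a'] are nontrivial, [B] is mapped trivially and the orders of 1, [a], [a'] are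
    separated in [A]. If one of them is trivial, the other and [b] need distinct orders different
    from 1. *)
Lemma separate_two_one (a a' : A) (b : B) :
  ~ sim a a' -> a <> 1 \/ b <> 1 -> a' <> 1 \/ b <> 1 ->
  exists (v : A -> nat) (w : B -> nat),
    [/\ realized v, realized w, v a <> v a', v a <> w b & v a' <> w b].
Proof.
move=> aa' ab a'b; have sep_from1 c : c <> 1 -> b <> 1 ->
    exists (v : A -> nat) (w : B -> nat),
      [/\ realized v, realized w, v 1 <> v c, v 1 <> w b & v c <> w b].
  move=> c1 b1; have [|v [w [rv rw vc wb vw]]] :=
    @separate_factors c b [:: c] [:: b]; first by left.
  exists v, w; split=> //; rewrite (realized_eq1 rv) => /esym.
    by apply: vc; rewrite ?mem_head.
  by apply: wb; rewrite ?mem_head.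
have [a1|/eqP a1] := eqVneq a 1.
  rewrite a1; apply: sep_from1; last by case: ab.
  by move=> a'1; apply: aa'; rewrite a1 a'1; apply: sim_refl.
have [a'1|/eqP a'1] := eqVneq a' 1.
  rewrite a'1; have [|v [w [rv rw h1 h2 h3]]] := sep_from1 _ a1; first by case: a'b.
  by exists v, w; split=> // /esym.
have [v rv vL] := separate_seq sepA [:: 1; a; a'].
exists v, (fun=> 1%N); rewrite -(realized_eq1 rv).
split=> //; rewrite ?(realized_eq1 rv); first exact: realized1.
- by apply: vL; rewrite ?inE ?eqxx ?orbT.
- by rewrite -(realized_eq1 rv); apply: vL; rewrite ?inE ?eqxx ?orbT // => /sim1.
- by rewrite -(realized_eq1 rv); apply: vL; rewrite ?inE ?eqxx ?orbT // => /sim1.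
Qed.

End TwoFactors.

(** * Action on truncated normal forms *)

Section TruncatedAction.
Variables (H K : finGroupType) (n : nat).
Implicit Types (x y z : H + K) (s : seq (H + K)) (u : free_product H K).

(** A letter acts if there is room for it or if it meets a head from its own factor, so that the
    length cannot grow; other words are fixed. This depends only on the factor and persists under
    its letters, so each factor acts. *)
Definition pushable x s : bool :=
  (size s < n) || (if s is y :: _ then ~~ alternates x y else false).

Definition trunc_push x s := if pushable x s then push_letter x s else s.

Lemma size_push_letter x s : size (push_letter x s) <= (size s).+1.
Proof.
rewrite /push_letter; case: letter1 => //; case: s => //= y s.
by case: letterM => [z|] //; case: ifP => //= _; rewrite ltnW.
Qed.

Lemma size_trunc_push x s : size s <= n -> size (trunc_push x s) <= n.
Proof.
rewrite /trunc_push; case: ifP => // /orP[sn _|].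
  exact: leq_trans (size_push_letter x s) sn.
case: s => // y s xy /= sn; rewrite /push_letter; case: ifP => // _.
by case: x y xy => [a|b] [a'|b'] //= _; case: ifP => //= _; rewrite ltnW.
Qed.

Lemma reduced_trunc_push x s : reduced s -> reduced (trunc_push x s).
Proof. by rewrite /trunc_push; case: ifP => // _; apply: reduced_push_letter. Qed.

Lemma pushable_push x y z s : letterM x y = Some z -> size s <= n ->
  pushable x s -> pushable x (push_letter y s).
Proof.
move=> xy sn; rewrite /push_letter; case: ifP => // y1.
case: s sn => [|t s] /= sn.
  by rewrite /pushable; case: x y xy {y1} => [a|b] [a'|b'] //= _; rewrite orbT.
case: x y t xy {y1} => [a|b] [a'|b'] [c|c] //= _;
  rewrite /pushable /alternates /= ?sn ?orbT ?orbF //; case: ifP => /=;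
  by rewrite ?sn ?orbT ?orbF.
Qed.

Lemma trunc_pushM x y z s : letterM x y = Some z -> size s <= n -> reduced s ->
  trunc_push x (trunc_push y s) = trunc_push z s.
Proof.
move=> xy sn rs; have [xs ys] : pushable x s = pushable z s /\
    pushable y s = pushable z s.
  by case: x y z xy => [a|b] [a'|b'] z //= [<-].
rewrite /trunc_push ys; case zs: (pushable z s); last by rewrite xs zs.
by rewrite (pushable_push xy) ?xs // (push_letterM xy).
Qed.

Lemma trunc_push1 x s : letter1 x -> trunc_push x s = s.
Proof. by move=> x1; rewrite /trunc_push push_letter1 // if_same. Qed.

Lemma trunc_push_word s : reduced s -> size s <= n ->
  foldr trunc_push [::] s = s.
Proof.
elim: s => //= x s IHs rs sn.
rewrite IHs ?(ltnW sn) //; last by move: rs; rewrite reduced_cons => /and3P[].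
by rewrite /trunc_push /pushable sn push_letter_reduced.
Qed.

Definition trunc_word := {s : n.-bseq (H + K) | reduced s}.

Lemma trunc_word_eq (s t : trunc_word) : val s = val t :> seq (H + K) -> s = t.
Proof. by move=> e; apply/val_inj/val_inj. Qed.

Definition trunc_nil : trunc_word := exist (fun s : n.-bseq (H + K) => reduced s) [bseq] isT.

Definition trunc_act x (s : trunc_word) : trunc_word :=
  exist (fun s : n.-bseq (H + K) => reduced s)
    (Bseq (size_trunc_push x (size_bseq (val s))))
    (reduced_trunc_push x (valP s)).

Lemma trunc_actM x y z (s : trunc_word) : letterM x y = Some z ->
  trunc_act x (trunc_act y s) = trunc_act z s.
Proof.
by move=> xy; apply: trunc_word_eq; rewrite /= (trunc_pushM xy) ?size_bseq ?(valP s).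
Qed.

Lemma trunc_act1 x (s : trunc_word) : letter1 x -> trunc_act x s = s.
Proof. by move=> x1; apply: trunc_word_eq; rewrite /= trunc_push1. Qed.

Lemma trunc_actVK x : cancel (trunc_act (letterV x)) (trunc_act x).
Proof.
move=> s; case: x => a.
  by rewrite (@trunc_actM _ _ (inl (a * a^-1))) // trunc_act1 //= mulgV.
by rewrite (@trunc_actM _ _ (inr (a * a^-1))) // trunc_act1 //= mulgV.
Qed.

(* Permutations compose from left to right, so this left action gives a
   morphism only after inverting the letter. *)
Definition trunc_perm x : {perm trunc_word} :=
  perm (can_inj (trunc_actVK x)).

Lemma trunc_permV x : (trunc_perm x)^-1 =1 trunc_act x.
Proof.
move=> s; apply: (@perm_inj _ (trunc_perm x)); rewrite permKV permE.
by have := trunc_actVK (letterV x) s; case: x => a; rewrite /= invgK.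
Qed.

Lemma trunc_permM x y z : letterM x y = Some z ->
  trunc_perm z = trunc_perm x * trunc_perm y.
Proof.
move=> xy; apply/permP=> s; rewrite permM !permE.
rewrite (@trunc_actM _ _ (letterV z)) //.
by case: x y z xy => [a|b] [a'|b'] z //= [<-] /=; rewrite invMg.
Qed.

Lemma trunc_inlM : {morph (fun a => trunc_perm (inl a)) : a a' / a * a'}.
Proof. by move=> a a'; apply: trunc_permM. Qed.

Lemma trunc_inrM : {morph (fun b => trunc_perm (inr b)) : b b' / b * b'}.
Proof. by move=> b b'; apply: trunc_permM. Qed.

Definition trunc_hom : UMagmaMorphism.type (free_product H K) {perm trunc_word} :=
  fp_lift (mkhom trunc_inlM) (mkhom trunc_inrM).

(** A word that fits is rebuilt letter by letter from the empty word. The inverse undoes the one in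
    [trunc_perm]. *)
Lemma trunc_homV u : size (fp_word u) <= n ->
  val ((trunc_hom u)^-1 trunc_nil) = fp_word u :> seq (H + K).
Proof.
move=> un; rewrite -[RHS](trunc_push_word (fp_wordP u) un) /= /fp_lift.
elim: (fp_word u) => [|x s IHs] /=; first by rewrite invg1 perm1.
rewrite invMg permM -IHs.
have -> : letter_lift (mkhom trunc_inlM) (mkhom trunc_inrM) x = trunc_perm x.
  by case: x.
by rewrite trunc_permV.
Qed.

Lemma trunc_hom_neq1 u : u <> 1 -> size (fp_word u) <= n -> trunc_hom u <> 1.
Proof.
move=> u1 un hu1; apply: u1; apply: val_inj => /=.
by rewrite -(trunc_homV un) hu1 invg1 perm1.
Qed.

End TruncatedAction.

(** * Finite quotients of free products with prescribed orders of letters *)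

Section MapLetters.
Variables (A B H K : groupType).
Variables (f : UMagmaMorphism.type A H) (g : UMagmaMorphism.type B K).

Definition map_letter (x : A + B) : H + K :=
  match x with inl a => inl (f a) | inr b => inr (g b) end.

Definition fp_map : UMagmaMorphism.type (free_product A B) (free_product H K) :=
  fp_lift (@fp_inl H K \o f) (@fp_inr H K \o g).

Lemma map_letter_alternates x y :
  alternates (map_letter x) (map_letter y) = alternates x y.
Proof. by case: x y => [a|b] [a'|b']. Qed.

Lemma fp_word_map z : {in fp_word z, forall x, ~~ letter1 (map_letter x)} ->
  fp_word (fp_map z) = map map_letter (fp_word z).
Proof.
move=> nt; have rz : reduced (map map_letter (fp_word z)).
  have /andP[_] := fp_wordP z; rewrite /reduced all_map sorted_map => sz.
  apply/andP; split; first by apply/allP=> x /nt.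
  by apply: sub_sorted sz => x y; rewrite /= map_letter_alternates.
rewrite /fp_map /= /fp_lift; elim: (fp_word z) rz => //= x s IHs rs.
have -> : letter_lift (@fp_inl H K \o f) (@fp_inr H K \o g) x =
  fp_letter (map_letter x) by case: (x).
rewrite /= word_mul_push ?fp_wordP //= IHs ?push_letter_reduced //.
by move: rs; rewrite reduced_cons => /and3P[].
Qed.

End MapLetters.

Lemma order_same_ker (G : groupType) (H K : finGroupType)
  (f : UMagmaMorphism.type G H) (g : UMagmaMorphism.type G K) :
  (forall x, f x = 1 <-> g x = 1) -> forall x, #[f x] = #[g x].
Proof.
move=> fg x; apply/eqP; rewrite eqn_dvd !order_dvdn -!gmulfXn.
apply/andP; split; apply/eqP.
  by apply/(fg _).2; rewrite gmulfXn expg_order.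
by apply/(fg _).1; rewrite gmulfXn expg_order.
Qed.

Definition letter_order (A B : Type) (v : A -> nat) (w : B -> nat) (x : A + B) :=
  match x with inl a => v a | inr b => w b end.

(** Map the factors to finite groups realizing [v] and [w], and let the free product of these act on
    truncated normal forms. If no letter of [z] dies, the normal form of its image has the same
    length and is seen by the action. *)
Lemma residually_finite_free_product (A B : groupType) (v : A -> nat)
  (w : B -> nat) (n : nat) : realized v -> realized w ->
  exists (Q : finGroupType) (q : UMagmaMorphism.type (free_product A B) Q),
    [/\ forall a, #[q (fp_inl B a)] = v a, forall b, #[q (fp_inr A b)] = w b
      & forall z, z <> 1 -> size (fp_word z) <= n ->
          {in fp_word z, forall x, letter_order v w x != 1%N} -> q z <> 1].
Proof.
move=> [H [f fv]] [K [g gw]].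
(* The bound [n.+1] leaves room for a single letter even if [n] is 0, which is needed to preserve
   the orders of letters. *)
pose q : UMagmaMorphism.type (free_product A B) _ := trunc_hom H K n.+1 \o fp_map f g.
have q_neq1 z : z <> 1 -> size (fp_word z) <= n.+1 ->
    {in fp_word z, forall x, letter_order v w x != 1%N} -> q z <> 1.
  move=> z1 zn nt; have wz := fp_word_map (f := f) (g := g) (z := z).
  have {}wz : fp_word (fp_map f g z) = map (map_letter f g) (fp_word z).
    by apply: wz => x /nt; case: x => c /=; rewrite -?fv -?gw order_eq1.
  apply: trunc_hom_neq1; last by rewrite wz size_map.
  move=> fz1; apply: z1; apply/val_inj/eqP.
  by rewrite -size_eq0 -(size_map (map_letter f g)) -wz fz1.
have q_letter x : q (fp_letter x) = 1 <-> letter_order v w x = 1%N.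
  split=> [qx|]; last first.
    rewrite /q /= /fp_map; case: x => c /= /eqP.
      by rewrite -fv order_eq1 fp_lift_inl /= => /eqP->; rewrite !gmulf1.
    by rewrite -gw order_eq1 fp_lift_inr /= => /eqP->; rewrite !gmulf1.
  apply/eqP/negPn/negP => nx; have x1 : ~~ letter1 x.
    by apply: contra nx; case: (x) => c /= /eqP->; rewrite -?fv -?gw gmulf1 order1.
  have wx : fp_word (fp_letter x) = [:: x] by rewrite /= /push_letter (negbTE x1).
  apply: (q_neq1 (fp_letter x)); rewrite ?wx //; last by move=> y; rewrite inE => /eqP->.
  by move=> /(congr1 (@fp_word A B)); rewrite wx.
exists _, q; split=> [a|b|z z1 zn]; last by apply: q_neq1 => //; apply: ltnW.
- rewrite -fv -[LHS]/(#[(q \o @fp_inl A B) a]); apply: order_same_ker => {}a.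
  by rewrite [_ a]/= (q_letter (inl a)) /= -fv; split=> [/eqP|->];
    rewrite ?order1 // order_eq1 => /eqP.
- rewrite -gw -[LHS]/(#[(q \o @fp_inr A B) b]); apply: order_same_ker => {}b.
  by rewrite [_ b]/= (q_letter (inr b)) /= -gw; split=> [/eqP|->];
    rewrite ?order1 // order_eq1 => /eqP.
Qed.

(** * Cyclically alternating words *)

Section CyclicWords.
Variables A B : groupType.
Local Notation G := (free_product A B).
Implicit Types (p : A * B) (c d : seq (A * B)) (s : seq (A + B)).

Definition word_el s : G := foldr (fun x g => fp_letter x * g) 1 s.

Lemma word_elE s : reduced s -> fp_word (word_el s) = s.
Proof.
elim: s => //= x s IHs rs; rewrite word_mul_push ?fp_wordP //=.
by rewrite IHs ?push_letter_reduced //; move: rs; rewrite reduced_cons => /and3P[].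
Qed.

Lemma word_el_cat s t : word_el (s ++ t) = word_el s * word_el t.
Proof. by elim: s => [|x s /= ->]; rewrite ?mul1g ?mulgA. Qed.

Lemma word_elK g : word_el (fp_word g) = g.
Proof. by apply/val_inj/word_elE/fp_wordP. Qed.

Definition flat c : seq (A + B) := flatten [seq [:: inl p.1; inr p.2] | p <- c].

Definition el c : G := foldr (fun p g => fp_inl B p.1 * fp_inr A p.2 * g) 1 c.

Definition reduced_pairs c := all (fun p => (p.1 != 1) && (p.2 != 1)) c.

Lemma el_cat c d : el (c ++ d) = el c * el d.
Proof. by elim: c => [|p c /= ->]; rewrite ?mul1g ?mulgA. Qed.

Lemma el_rep n c : el (rep n c) = el c ^+ n.
Proof. by elim: n => // n IHn; rewrite /rep /= el_cat -!/(rep _ _) IHn expgS. Qed.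

Lemma reduced_pairs_cat c d : reduced_pairs (c ++ d) = reduced_pairs c && reduced_pairs d.
Proof. exact: all_cat. Qed.

Lemma reduced_pairs_rep n c : reduced_pairs c -> reduced_pairs (rep n c).
Proof. by move=> gc; elim: n => // n IHn; rewrite /rep /= reduced_pairs_cat gc. Qed.

Lemma el_flat c : el c = word_el (flat c).
Proof. by elim: c => //= p c ->; rewrite mulgA. Qed.

Lemma flat_inj c d : flat c = flat d -> c = d.
Proof.
by elim: c d => [|[a b] c IHc] [|[a' b'] d] //= [<- <- /IHc->].
Qed.

Lemma flat_path b c : path (@alternates A B) (inr b) (flat c).
Proof. by elim: c b => //= p c IHc b; rewrite /alternates /=; apply: IHc. Qed.

Lemma reduced_pairs_flat c : reduced_pairs c -> all (predC (@letter1 A B)) (flat c).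
Proof. by elim: c => //= p c IHc /andP[/andP[-> ->]]. Qed.

Lemma reduced_flat c : reduced_pairs c -> reduced (flat c).
Proof.
move=> gc; rewrite /reduced reduced_pairs_flat //.
by have := flat_path 1 c; case: (flat c) => //= x s /andP[].
Qed.

Lemma el_inj c d : reduced_pairs c -> reduced_pairs d -> el c = el d -> c = d.
Proof.
move=> gc gd; rewrite !el_flat => /(congr1 (@fp_word A B)).
by rewrite !word_elE ?reduced_flat // => /flat_inj.
Qed.

(** The normal form starts in [B] on the left and in [A] on the right. *)
Lemma conjugate_flip_neq a b c d : a != 1 -> b != 1 -> reduced_pairs c -> reduced_pairs d ->
  c != [::] -> fp_inr A b * el d * fp_inl B a <> el c.
Proof.
move=> a1 b1 gc gd c0; have -> : fp_inr A b * el d * fp_inl B a =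
    word_el (inr b :: flat d ++ [:: inl a]).
  by rewrite /= word_el_cat -el_flat /= mulg1 mulgA.
rewrite el_flat => /(congr1 (@fp_word A B)).
rewrite !word_elE ?reduced_flat //; first by case: c c0 {gc}.
rewrite /reduced /= all_cat reduced_pairs_flat //= a1 b1 cat_path flat_path /= andbT.
by elim: d b {b1 gd} => //= p d IHd b.
Qed.

Lemma el_conj_odd a b c d :
  el (c ++ (a, b) :: d) ^ (el c * fp_inl B a) =
  fp_inr A b * el (d ++ c) * fp_inl B a.
Proof. by rewrite conjgE !el_cat /= -!mulgA invMg -!mulgA !mulKg. Qed.

(* Conjugating an alternating word by a prefix of odd length makes it begin in B;
   its inverse begins in A again, and is spelled by [flip]. *)
Fixpoint flip a d b : seq (A * B) :=
  if d is p :: d' then (a, p.2^-1) :: flip p.1^-1 d' b else [:: (a, b)].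

Lemma el_flip a d b : el (flip a (rev d) b) = fp_inl B a * (el d)^-1 * fp_inr A b.
Proof.
elim/last_ind: d a => [|d p IHd] a; first by rewrite /= invg1 !mulg1.
rewrite rev_rcons /= IHd -cats1 el_cat /= mulg1 !invMg !gmulfV !mulgA.
by [].
Qed.

Lemma reduced_pairs_flip a d b : a != 1 -> b != 1 -> reduced_pairs d -> reduced_pairs (flip a d b).
Proof.
elim: d a => [|p d IHd] a a1 b1 /=; first by rewrite a1 b1.
by case/andP=> /andP[p1 p2] gd; rewrite a1 /= eq_invg1 p2 IHd // eq_invg1.
Qed.

Lemma size_flip a d b : size (flip a d b) = (size d).+1.
Proof. by elim: d a => //= p d IHd a; rewrite IHd. Qed.

(** Prefixes are taken letter by letter, with the empty one and without the whole word: they are the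
    vertices of one turn of the closed path. [behead] drops the empty prefix. *)
Fixpoint prefixes c : seq G :=
  if c is p :: c' then
    [:: 1, fp_inl B p.1 & [seq fp_inl B p.1 * fp_inr A p.2 * g | g <- prefixes c']]
  else [::].

Lemma prefixesP c g : g \in prefixes c -> exists c1 p c2,
  c = c1 ++ p :: c2 /\ (g = el c1 \/ g = el c1 * fp_inl B p.1).
Proof.
elim: c g => //= p c IHc g; rewrite !inE => /or3P[/eqP->|/eqP->|/mapP[h hc ->]].
- by exists [::], p, c; split=> //; left.
- by exists [::], p, c; split=> //; right; rewrite mul1g.
have [c1 [p' [c2 [-> hE]]]] := IHc h hc; exists (p :: c1), p', c2.
by split=> //; case: hE => ->; [left|right]; rewrite //= mulgA.
Qed.

Lemma proper_prefixesP c g : g \in behead (prefixes c) -> exists c1 p c2,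
  c = c1 ++ p :: c2 /\
  (c1 != [::] /\ g = el c1 \/ g = el c1 * fp_inl B p.1).
Proof.
case: c => //= p c; rewrite inE => /predU1P[->|/mapP[h hc ->]].
  by exists [::], p, c; split=> //; right; rewrite mul1g.
have [c1 [p' [c2 [-> hE]]]] := prefixesP hc; exists (p :: c1), p', c2.
by split=> //; case: hE => ->; [left|right]; rewrite //= mulgA.
Qed.

Definition minimal_root c := reduced_pairs c /\
  forall d m, reduced_pairs d -> sim (el c) (el d ^+ m) -> (size c <= size d)%N.

Lemma el_eq1 c : reduced_pairs c -> el c = 1 -> c = [::].
Proof. by move=> gc e; apply: el_inj. Qed.

(** Take the shortest [d] such that [el c] is equivalent to a power of [el d]; a root of [el d] is
    also a root of [el c], hence not shorter. *)
Lemma minimal_root_exists c : reduced_pairs c -> c != [::] ->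
  exists d k, [/\ minimal_root d, d != [::], (0 < k)%N & sim (el c) (el d ^+ k)].
Proof.
move=> gc c0; pose P n :=
  `[< exists d k, [/\ reduced_pairs d, size d = n & sim (el c) (el d ^+ k)] >].
have exP : exists n, P n.
  exists (size c); apply/asboolP; exists c, 1%N.
  by split; rewrite ?expg1 //; apply: sim_refl.
case: (ex_minnP exP) => n /asboolP[d [k [gd dn ck]]] min_n; exists d, k.
have nz g : sim (el c) g -> g <> 1.
  by move=> /[swap] ->  /sim1/(el_eq1 gc) /eqP; apply/negP.
split=> //; last 1 first.
- by rewrite lt0n; apply/eqP=> k0; apply: nz ck _; rewrite k0 expg0.
- split=> // z m gz dz; rewrite dn; apply: min_n; apply/asboolP.
  exists z, (m * k)%N; split=> //; apply: sim_trans ck _.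
  by rewrite expgM; apply: simX.
by apply/eqP=> d0; apply: nz ck _; rewrite d0 expg1n.
Qed.

(** A commuting prefix of even length commutes with [c] already as a word, which makes [c] a proper
    power. Conjugation by a prefix of odd length gives an element starting in [B], which cannot be
    [el c]. *)
Lemma minimal_root_prefix c g : minimal_root c ->
  g \in behead (prefixes c) -> [~ g, el c] != 1.
Proof.
move=> [gc min_c] /proper_prefixesP[c1 [[a b] [c2 [cE gE]]]].
apply/negP=> /commgP gcomm.
have : reduced_pairs (c1 ++ (a, b) :: c2) by rewrite -cE.
rewrite reduced_pairs_cat /= => /and3P[gc1 /andP[a1 b1] gc2].
case: gE => [[c10 gE]|gE].
  have : c1 ++ ((a, b) :: c2) = ((a, b) :: c2) ++ c1.
    have /el_inj : el (c1 ++ c) = el (c ++ c1) by rewrite !el_cat -gE.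
    rewrite !reduced_pairs_cat gc gc1 => /(_ isT isT)/eqP.
    by rewrite cE -catA eqseq_cat // eqxx => /eqP.
  move=> /commuting_words[z [i [j [c1E c2E]]]].
  have cz : c = rep (i + j) z by rewrite repD -c1E -c2E.
  have gz : reduced_pairs z.
    move: gc1 c10; rewrite c1E; case: (i) => // i'.
    by rewrite /rep /= reduced_pairs_cat => /andP[].
  (* Both [i] and [j] are positive, so [z] is shorter than [c]. *)
  have := min_c z (i + j)%N gz; rewrite -el_rep -cz => /(_ (sim_refl _)).
  rewrite cz size_rep.
  have := congr1 size c2E; rewrite size_rep /=.
  move: c10; rewrite c1E -size_eq0 size_rep muln_eq0 negb_or => /andP[i0 z0].
  case: (j) => // j' _; move: i0 z0; case: (i) => // i'.
  by case: (size z) => // m _ _; nia.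
have gz : reduced_pairs (c2 ++ c1) by rewrite reduced_pairs_cat gc2 gc1.
apply: (conjugate_flip_neq a1 b1 gc gz); first by rewrite cE; case: (c1).
have -> : el c = (el c) ^ g.
  by apply/esym/conjg_fixP; apply/commgP; exact: commute_sym.
by rewrite gE cE el_conj_odd.
Qed.

(** An even prefix rotates the word. After an odd one the word starts in [B], and its inverse is
    spelled by [flip]. *)
Lemma conjugate_prefix c g : reduced_pairs c -> g \in prefixes c ->
  exists d, [/\ reduced_pairs d, size d = size c &
                el c ^ g = el d \/ el c ^ g = (el d)^-1].
Proof.
move=> gc /prefixesP[c1 [[a b] [c2 [cE gE]]]].
have : reduced_pairs (c1 ++ (a, b) :: c2) by rewrite -cE.
rewrite reduced_pairs_cat /= => /and3P[gc1 /andP[a1 b1] gc2].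
case: gE => ->.
  exists ((a, b) :: c2 ++ c1); split; last 1 first.
  - by left; rewrite conjgE cE -cat_cons !el_cat -!mulgA mulKg.
  - by rewrite /= reduced_pairs_cat a1 b1 gc1 gc2.
  - by rewrite cE /= !size_cat /= addnS addnC.
exists (flip a^-1 (rev (c2 ++ c1)) b^-1); split; last 1 first.
- by right; rewrite cE el_conj_odd el_flip !invMg !gmulfV !invgK !mulgA.
- rewrite reduced_pairs_flip ?eq_invg1 // /reduced_pairs all_rev.
  by rewrite -/(reduced_pairs _) reduced_pairs_cat gc1 gc2.
- by rewrite size_flip size_rev cE !size_cat /= addnS addnC.
Qed.

(** Up to inversion the conjugate of [el s] is [el t] with [t] as long as [s]. As words, [t]
    commutes with a power of [r], hence with [r]; both are then powers of one word, and minimality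
    makes both exponents 1. *)
Lemma dependent_roots r (s : seq (A * B)) g n : minimal_root r -> minimal_root s ->
  r != [::] -> s != [::] -> g \in prefixes s -> (0 < n)%N ->
  [~ el r ^+ n, el s ^ g] = 1 -> sim (el r) (el s).
Proof.
move=> [gr min_r] [gs min_s] r0 s0 gP n0 /eqP/commgP comm_rs.
have [t [gt st tE]] := conjugate_prefix gs gP.
have {}comm_rs : commute (el r ^+ n) (el t).
  by case: tE comm_rs => -> // /commuteV; rewrite invgK.
have st_sim : sim (el s) (el t).
  by case: tE => tE; apply: sim_trans (sim_conj _ g) _; rewrite tE;
    [apply: sim_refl | apply/sim_sym/sim_inv].
have rt : t ++ r = r ++ t.
  apply: (@commuting_trans _ (rep n r)).
  - by rewrite -size_eq0 size_rep muln_eq0 negb_or -lt0n n0 size_eq0.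
  - have gn := reduced_pairs_rep n gr; apply: el_inj; rewrite ?reduced_pairs_cat ?gt ?gn //.
    by rewrite !el_cat el_rep -comm_rs.
  - exact: commuting_rep.
have [z [j [i [tz rz]]]] := commuting_words rt.
have gz : reduced_pairs z.
  move: gr r0; rewrite rz; case: (i) => // i'.
  by rewrite /rep /= reduced_pairs_cat => /andP[].
have z0 : (0 < size z)%N.
  by move: r0; rewrite rz -size_eq0 size_rep muln_eq0 negb_or -!lt0n => /andP[].
have i0 : (0 < i)%N by move: r0; rewrite rz; case: (i).
have j0 : (0 < j)%N.
  by move: s0; rewrite -size_eq0 -st tz size_rep; case: (j).
have i1 : i = 1%N.
  have := min_r z i gz; rewrite -el_rep -rz => /(_ (sim_refl _)).
  by rewrite rz size_rep -[leqRHS]mul1n leq_pmul2r //; lia.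
have j1 : j = 1%N.
  have := min_s z j gz; rewrite -el_rep -tz => /(_ st_sim).
  by rewrite -st tz size_rep -[leqRHS]mul1n leq_pmul2r //; lia.
by apply: sim_sym; rewrite rz i1 -j1 -tz.
Qed.

Lemma el_surj (g : G) : exists c, g = el c.
Proof.
rewrite -(word_elK g); elim: (fp_word g) => [|x s [c /= ->]]; first by exists [::].
case: x => [a|b].
  by exists ((a, 1) :: c); rewrite /= gmulf1 mulg1.
by exists ((1, b) :: c); rewrite /= gmulf1 mul1g.
Qed.

Lemma sim_el_rot c d : sim (el (c ++ d)) (el (d ++ c)).
Proof. by left; exists (el c); rewrite !el_cat conjgE -!mulgA mulKg. Qed.

(** Induction on the number of pairs. A pair with a trivial entry is rotated to the front; its other
    entry merges with a cyclic neighbour from the same factor, or is left alone as a letter. *)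
Lemma conjugacy_classes (g : G) : (exists x, sim g (fp_letter x)) \/
  exists c k, [/\ minimal_root c, c != [::], (0 < k)%N & sim g (el c ^+ k)].
Proof.
have [c ->] := el_surj g; move: {2}(size c) (leqnn (size c)) => n.
have letter1_case : exists x, sim 1 (fp_letter x : G).
  by exists (inl 1); rewrite -[fp_letter _]/(fp_inl B 1) gmulf1; apply: sim_refl.
elim: n c => [|n IHn] c cn; first by left; case: c cn.
have IH g1 : (exists2 d, (size d <= n)%N & sim g1 (el d)) ->
    (exists x, sim g1 (fp_letter x)) \/
    exists c k, [/\ minimal_root c, c != [::], (0 < k)%N & sim g1 (el c ^+ k)].
  move=> [d dn g1d]; have [[x dx]|[z [k [? ? ? dz]]]] := IHn d dn.
    by left; exists x; apply: sim_trans dx.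
  by right; exists z, k; split=> //; apply: sim_trans dz.
have [gc|] := boolP (reduced_pairs c).
  have [->|c0] := eqVneq c [::]; first by left.
  have [d [k [*]]] := minimal_root_exists gc c0.
  by right; exists d, k.
move=> /allPn[[a b] abc]; case/splitPr: abc cn => c1 c2.
rewrite size_cat addnS ltnS -size_cat /= => cn ab1.
have c_rot := sim_el_rot c1 ((a, b) :: c2).
have [d ddef] : exists d, d = c2 ++ c1 by exists (c2 ++ c1).
have dn : (size d <= n)%N by rewrite ddef size_cat addnC -size_cat.
have c_d : sim (el (c1 ++ (a, b) :: c2)) (fp_inl B a * fp_inr A b * el d).
  by rewrite ddef.
move: ab1; rewrite negb_and !negbK => /orP[]/eqP e.
  have {}c_d : sim (el (c1 ++ (a, b) :: c2)) (el d * fp_inr A b).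
    apply: sim_trans c_d _; rewrite e gmulf1 mul1g.
    by left; exists (fp_inr A b); rewrite conjgE -!mulgA mulKg.
  case/lastP: d dn c_d {ddef} => [|d [a' b']] dn c_d.
    by left; exists (inr b); rewrite /= mul1g in c_d.
  apply: IH; exists (rcons d (a', b' * b)); first by move: dn; rewrite !size_rcons.
  by move: c_d; rewrite -!cats1 !el_cat /= gmulfM !mulg1 !mulgA.
have {}c_d : sim (el (c1 ++ (a, b) :: c2)) (fp_inl B a * el d).
  by move: c_d; rewrite e gmulf1 mulg1.
case: d dn c_d {ddef} => [|[a' b'] d] dn c_d.
  by left; exists (inl a); rewrite /= mulg1 in c_d.
apply: IH; exists ((a * a', b') :: d) => //.
by move: c_d; rewrite /= gmulfM !mulgA.
Qed.

End CyclicWords.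

(** * Voltage covers *)

Section Cover.
Variables (A B : groupType) (Q U : finGroupType).
Local Notation G := (free_product A B).
Variables (q : UMagmaMorphism.type G Q) (label : Q -> U).
Implicit Types (g h : G) (x y : Q) (u : U) (c : seq (A * B)).

Lemma translate_inj x : injective (fun z : Q * U => (z.1 * x, z.2)).
Proof. by move=> [y u] [z v] [/mulIg-> ->]. Qed.

Definition translate x : {perm Q * U} := perm (@translate_inj x).

Lemma twist_inj : injective (fun z : Q * U => (z.1, z.2 * label z.1)).
Proof. by move=> [y u] [z v] [-> /mulIg->]. Qed.

Definition twist : {perm Q * U} := perm twist_inj.

Lemma translateE x y u : translate x (y, u) = (y * x, u).
Proof. by rewrite permE. Qed.

Lemma translateM : {morph translate : x y / x * y}.
Proof. by move=> x y; apply/permP=> -[z u]; rewrite permM !translateE mulgA. Qed.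

Lemma translate_eq1 x : translate x = 1 <-> x = 1.
Proof.
split=> [|->]; last by apply/permP=> -[z u]; rewrite translateE mulg1 perm1.
by move=> /permP/(_ (1, 1)); rewrite translateE perm1 mul1g => -[].
Qed.

Lemma twistV y u : twist^-1 (y, u) = (y, u * (label y)^-1).
Proof. by apply: (@perm_inj _ twist); rewrite permKV permE /= mulgKV. Qed.

Lemma cover_inlM : {morph (fun a => translate (q (fp_inl B a))) : a b / a * b}.
Proof. by move=> a b; rewrite !gmulfM translateM. Qed.

Lemma cover_inrM : {morph (fun b => translate (q (fp_inr A b)) ^ twist) : a b / a * b}.
Proof. by move=> a b; rewrite !gmulfM translateM conjMg. Qed.

Definition voltage_cover : UMagmaMorphism.type G {perm Q * U} :=
  fp_lift (mkhom cover_inlM) (mkhom cover_inrM).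

Lemma cover_inl_order a : #[voltage_cover (fp_inl B a)] = #[q (fp_inl B a)].
Proof.
apply: (order_same_ker (f := voltage_cover \o @fp_inl A B) (g := q \o @fp_inl A B)) => {}a /=.
by rewrite /voltage_cover fp_lift_inl /= translate_eq1.
Qed.

Lemma cover_inr_order b : #[voltage_cover (fp_inr A b)] = #[q (fp_inr A b)].
Proof.
apply: (order_same_ker (f := voltage_cover \o @fp_inr A B) (g := q \o @fp_inr A B)) => {}b /=.
rewrite /voltage_cover fp_lift_inr /= -translate_eq1.
by split=> [/eqP|->]; rewrite ?conj1g // conjg_eq1 => /eqP.
Qed.

(** The product of voltages along the path of [c] from [x]: an edge of [A] carries 1, and an edge of
    [B] from [y] to [z] carries [(label y)^-1 * label z]. *)
Fixpoint holonomy c x : U :=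
  if c is p :: c' then
    let y := x * q (fp_inl B p.1) in
    (label y)^-1 * label (y * q (fp_inr A p.2)) * holonomy c' (y * q (fp_inr A p.2))
  else 1.

Lemma cover_el c x u :
  voltage_cover (el c) (x, u) = (x * q (el c), u * holonomy c x).
Proof.
elim: c x u => [|[a b] c IHc] x u.
  by rewrite /= !gmulf1 perm1 !mulg1.
rewrite [el _]/= !gmulfM !permM [voltage_cover (fp_inl B a)]fp_lift_inl.
rewrite [voltage_cover (fp_inr A b)]fp_lift_inr /= translateE /conjg !permM twistV.
by rewrite translateE permE /= IHc !mulgA.
Qed.

Definition volt g x : U := (voltage_cover g (x, 1)).2.

Lemma coverE g x u : voltage_cover g (x, u) = (x * q g, u * volt g x).
Proof. by have [c ->] := el_surj g; rewrite /volt !cover_el mul1g. Qed.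

Lemma volt_el c x : volt (el c) x = holonomy c x.
Proof. by rewrite /volt cover_el mul1g. Qed.

Lemma voltM g h x : volt (g * h) x = volt g x * volt h (x * q g).
Proof. by rewrite {1}/volt gmulfM permM !coverE mul1g. Qed.

Lemma volt1 x : volt 1 x = 1.
Proof. by rewrite /volt gmulf1 perm1. Qed.

Lemma volt_loopX g x n : q g = 1 -> volt (g ^+ n) x = volt g x ^+ n.
Proof.
move=> qg; elim: n => [|n IHn]; first by rewrite volt1.
by rewrite !expgS voltM qg mulg1 IHn.
Qed.

(** [g ^+ #[q g]] fixes first coordinates and multiplies second ones by its voltage. *)
Lemma cover_order_dvd g m :
  (forall x, volt (g ^+ #[q g]) x ^+ m = 1) -> #[voltage_cover g] %| #[q g] * m.
Proof.
move=> vm; have qo : q (g ^+ #[q g]) = 1 by rewrite gmulfXn expg_order.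
rewrite order_dvdn -gmulfXn expgM; apply/eqP/permP=> -[x u].
by rewrite coverE volt_loopX // vm gmulfXn qo expg1n !mulg1 perm1.
Qed.

Lemma dvd_cover_order g x : #[q g] * #[volt (g ^+ #[q g]) x] %| #[voltage_cover g].
Proof.
have cg : voltage_cover (g ^+ #[voltage_cover g]) = 1 by rewrite gmulfXn expg_order.
have /dvdnP[n nE] : #[q g] %| #[voltage_cover g].
  rewrite order_dvdn -gmulfXn; apply/eqP.
  by have := coverE (g ^+ #[voltage_cover g]) 1 1; rewrite cg perm1 mul1g => -[].
rewrite nE mulnC dvdn_pmul2r ?order_gt0 // order_dvdn -volt_loopX; last first.
  by rewrite gmulfXn expg_order.
by rewrite -expgM mulnC -nE /volt cg perm1.
Qed.

Section Character.
Variables (V : zmodType) (chi : U -> V).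
Hypothesis chiM : {morph chi : u v / u * v >-> (u + v)%R}.

Lemma chi1 : chi 1 = 0%R.
Proof. by apply: (addrI (chi 1)); rewrite -chiM mulg1 addr0. Qed.

Lemma chiV u : chi u^-1 = (- chi u)%R.
Proof. by apply: (addrI (chi u)); rewrite -chiM mulgV chi1 subrr. Qed.

Lemma chi_voltX g x n :
  chi (volt (g ^+ n) x) = (\sum_(j < n) chi (volt g (x * q g ^+ j)))%R.
Proof.
elim: n => [|n IHn]; first by rewrite volt1 chi1 big_ord0.
by rewrite expgSr voltM chiM IHn big_ord_recr /= gmulfXn.
Qed.

(** The character turns the holonomy into a sum of differences over the edges of [B]. The starting
    point is left along an edge of [A], so only the label of the end point remains. *)
Lemma chi_holonomy c x : c != [::] ->
  {in behead (prefixes c), forall g, chi (label (x * q g)) = 0%R} ->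
  chi (volt (el c) x) = chi (label (x * q (el c))).
Proof.
rewrite volt_el; elim: c x => // -[a b] c IHc x _ /= vanish.
have va : chi (label (x * q (fp_inl B a))) = 0%R.
  by apply: vanish; rewrite mem_head.
rewrite !chiM chiV va oppr0 add0r -mulgA -gmulfM.
have [->|c0] := eqVneq c [::]; first by rewrite /= chi1 addr0 mulg1.
rewrite IHc // => [|g gc]; last first.
  rewrite -mulgA -gmulfM; apply: vanish; rewrite inE; apply/orP; right.
  by apply: map_f; apply: mem_behead.
rewrite -!mulgA -!gmulfM !mulgA [X in (X + _)%R]vanish ?add0r //.
rewrite inE; apply/orP; right; apply/mapP; exists 1; rewrite ?mulg1 //.
by case: c c0 {IHc vanish} => // p c _; rewrite mem_head.
Qed.

Lemma chi_avoiding c x n : c != [::] ->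
  (forall j, {in prefixes c, forall g,
     chi (label (x * q (el c) ^+ j * q g)) = 0%R}) ->
  chi (volt (el c ^+ n) x) = 0%R.
Proof.
move=> c0 vanish; rewrite chi_voltX big1 // => j _.
rewrite chi_holonomy //; last by move=> g /mem_behead; apply: vanish.
(* The end of one turn is the empty prefix of the next. *)
have := vanish j.+1 1; rewrite gmulf1 mulg1 expgSr mulgA; apply.
by case: c c0 {vanish} => // p c _; rewrite mem_head.
Qed.

(** If the path met [y] at a nonempty proper prefix, the image of that prefix would be a power of
    [q (el c)] and commute with it. So [y] is met only at ends of turns, and at exactly one of
    them. *)
Lemma chi_hitting c y v : c != [::] ->
  {in behead (prefixes c), forall g, q [~ g, el c] != 1} ->
  y \in <[q (el c)]> ->
  (forall x, chi (label x) = if x == y then v else 0%R) ->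
  chi (volt (el c ^+ #[q (el c)]) 1) = v.
Proof.
move=> c0 c_prefix yc chi_label; set r := q (el c).
have chi_j j : chi (volt (el c) (1 * r ^+ j)) = if r ^+ j.+1 == y then v else 0%R.
  rewrite chi_holonomy // => [|g gc]; rewrite mul1g chi_label -?expgSr //.
  case: eqP => // gy; have := c_prefix g gc; rewrite gmulfR; case/negP.
  apply/commgP/commute_sym; suff : q g \in <[r]> by move/cycleP=> [i ->]; apply: commuteX.
  by rewrite -(groupMl _ (mem_cycle r j)) gy.
rewrite chi_voltX (eq_bigr _ (fun (j : 'I_#[r]) _ => chi_j j)).
have : y * r^-1 \in <[r]> by rewrite groupM // groupV cycle_id.
move=> /cyclePmin[j0 j0_lt yE].
have {}yE : y = r ^+ j0.+1 by rewrite expgSr -yE mulgKV.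
rewrite (bigD1 (Ordinal j0_lt)) //= yE eqxx big1 ?addr0 // => j jj0.
case: eqP => // /eqP; rewrite !expgSr (inj_eq (mulIg r)) eq_expg_mod_order.
rewrite !modn_small //.
by move=> e; case/negP: jj0; apply/eqP/val_inj/eqP.
Qed.

End Character.

End Cover.

(** * Covers that separate the orders of roots *)

Section SeparatingCovers.
Variables (A B : groupType) (Q : finGroupType).
Local Notation G := (free_product A B).
Variable q : UMagmaMorphism.type G Q.
Implicit Types (g h : G) (x y : Q) (c d : seq (A * B)).

Definition prefix_free c :=
  {in behead (prefixes c), forall g, q [~ g, el c] != 1}.

(** The bound on [n] fits the pigeonhole in [avoiding_point]: one more power of [el c] than there
    are positions on the path of [d]. *)
Definition independent c d := forall n, (0 < n <= size (prefixes d))%N ->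
  {in prefixes d, forall g, q [~ el c ^+ n, el d ^ g] != 1}.

Definition same_letter_orders (w : G -> nat) :=
  (forall a, w (fp_inl B a) = #[q (fp_inl B a)]) /\
  (forall b, w (fp_inr A b) = #[q (fp_inr A b)]).

(** With the single label 1 at the identity of [Q], the closed path of [c] has holonomy 1, a
    generator of the cyclic group ['I_k.+2]. *)
Lemma multiple_cover k : exists w : G -> nat,
  [/\ realized w, same_letter_orders w, forall g, w g %| #[q g] * k.+2
    & forall c, c != [::] -> prefix_free c -> k.+2 %| w (el c)].
Proof.
pose label y : 'I_k.+2 := if y == 1 then 1%R else 0%R.
exists (fun g => #[voltage_cover q label g]); split=> [||g|c c0 pc].
- by exists _, (voltage_cover q label).
- by split=> ?; [apply: cover_inl_order | apply: cover_inr_order].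
- apply: cover_order_dvd => x.
  by rewrite -[k.+2]card_ord -cardsT expg_cardG ?inE.
have u1 : volt q label (el c ^+ #[q (el c)]) 1 = 1%R.
  have idM : {morph (id : 'I_k.+2 -> 'I_k.+2) : u v / u * v >-> (u + v)%R} by [].
  exact: (chi_hitting idM c0 pc (group1 _) (v := 1%R)).
have := dvd_cover_order q label (el c) 1; rewrite u1 order_Zp1.
by apply: dvdn_trans; apply: dvdn_mull.
Qed.

(* If every power of c lay on the translate by x of the closed path of d, two
   of the first ones would lie at the same position of d, so that a power of c
   would commute in Q with a conjugate of d. *)
Lemma avoiding_point c d x : independent c d ->
  exists y, y \in <[q (el c)]> /\
    forall j, {in prefixes d, forall g, x * q (el d) ^+ j * q g != y}.
Proof.
move=> cd; apply: contrapT => hyp; set r := q (el c); set s := q (el d).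
pose n := size (prefixes d).
have hit (i : 'I_n.+1) : exists m : 'I_n, exists j,
    x * s ^+ j * q (nth 1 (prefixes d) m) = r ^+ i.
  apply: contrapT => nohit; apply: hyp; exists (r ^+ i); split=> [|j g gd].
    exact: mem_cycle.
  apply/eqP=> e; apply: nohit; have gn : (index g (prefixes d) < n)%N by rewrite index_mem.
  by exists (Ordinal gn), j; rewrite nth_index.
have [m mP] := choice hit.
have : ~~ injectiveb m.
  by apply/negP => /injectiveP/leq_card; rewrite !card_ord ltnn.
move=> /injectivePn[i [i' ii' mE]].
wlog lt_ii' : i i' ii' mE / (i < i')%N.
  move=> th_sym; case: (ltngtP i i') => [lt|lt|/val_inj e].
  - exact: (th_sym i i').
  - by apply: (th_sym i' i); rewrite // eq_sym.
  - by rewrite e eqxx in ii'.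
have [[j ji] [j' ji']] := (mP i, mP i'); set g := nth 1 _ _ in ji.
rewrite -mE -/g in ji'.
have gd : g \in prefixes d by rewrite mem_nth.
have := cd (i' - i)%N _ g gd; rewrite subn_gt0 lt_ii' leq_subLR.
have -> : (i' <= i + size (prefixes d))%N by have := ltn_ord i'; rewrite /n; lia.
move=> /(_ isT)/negP; apply; rewrite gmulfR gmulfXn gmulfJ -/r -/s; apply/commgP.
have -> : r ^+ (i' - i) = (s ^- j * s ^+ j') ^ q g.
  apply: (mulgI (r ^+ i)); rewrite -expgD subnKC; last exact: ltnW.
  by rewrite -ji' -ji conjgE -!mulgA !mulKVg.
apply: commute_sym; rewrite /commute -!conjMg; congr (_ ^ _).
by apply: commuteM; [apply/commuteV/commuteX | apply: commuteX].
Qed.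

(** Each [x] in [Q] gets its own superdiagonal position, for which [#|Q| <= p] makes room. The entry
    there is 1 only at a power of [q (el c)] missed by the path of [d] from [x]. *)
Lemma separating_cover p c d : prime p -> (#|Q| <= p)%N -> c != [::] ->
  d != [::] -> prefix_free c -> independent c d ->
  exists w : G -> nat,
  [/\ realized w, same_letter_orders w, forall g, w g %| #[q g] * p ^ 2,
      p ^ 2 %| w (el c) & w (el d) %| #[q (el d)] * p].
Proof.
move=> p_pr Qp c0 d0 pc cd.
have [U [chi [chiM chi_p U_p2 chi_surj]]] := unitriangular_group p_pr.
have [e eP] := choice (fun x => avoiding_point x cd).
(* Positions beyond the size of [Q] repeat the point of the default 1; it too is a power of
   [q (el c)]. *)
pose e_ (t : 'I_p) := e (nth 1 (enum Q) t).
have [label labelP] :=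
  choice (fun y => chi_surj (fun t => if y == e_ t then 1%R else 0%R)).
exists (fun g => #[voltage_cover q label g]); split=> [||g||].
- by exists _, (voltage_cover q label).
- by split=> ?; [apply: cover_inl_order | apply: cover_inr_order].
- exact: cover_order_dvd.
- set u := volt q label (el c ^+ #[q (el c)]) 1.
  have up : u ^+ p != 1.
    rewrite chi_p negb_exists; apply/forallP=> t.
    rewrite (@chi_hitting _ _ _ _ q label _ (chi t) (chiM t) c (e_ t) 1%R) ?oner_eq0 //.
    by have [] := eP (nth 1 (enum Q) t).
  have := dvd_cover_order q label (el c) 1; apply: dvdn_trans.
  suff -> : #[u] = (p ^ 2)%N by apply: dvdn_mull.
  have : #[u] %| p ^ 2 by rewrite order_dvdn U_p2.
  (* A divisor of [p ^ 2] that does not divide [p] is [p ^ 2]. *)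
  move=> /(dvdn_pfactor _ _ p_pr)[m m2 uE]; move: up; rewrite -order_dvdn uE.
  by case: m m2 {uE} => [|[|[|m]]] // _; rewrite ?expn0 ?dvd1n ?expn1 ?dvdnn.
apply: cover_order_dvd => x; apply/eqP; rewrite chi_p; apply/existsP.
have xp : (index x (enum Q) < p)%N.
  by apply: leq_trans Qp; rewrite cardE index_mem mem_enum.
exists (Ordinal xp); apply/eqP.
apply: chi_avoiding => // j g gd; rewrite labelP ifN //.
by rewrite /e_ /= nth_index ?mem_enum //; have [_] := eP x; apply.
Qed.

(** Induction on [L], with a new prime for each pair. Since the cover for [p] has orders dividing
    [#|Q| * p ^ 2], least common multiples keep the valuations at the other chosen primes. *)
Lemma separate_roots (k : nat) (R : seq (seq (A * B)))
  (L : seq (seq (A * B) * seq (A * B))) :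
  {in R, forall c, c != [::] /\ prefix_free c} ->
  {in L, forall z, [/\ z.1 \in R, z.2 \in R & independent z.1 z.2]} ->
  exists w : G -> nat,
  [/\ realized w, same_letter_orders w, {in R, forall c, k.+2 %| w (el c)}
    & {in L, forall z, exists p,
        [/\ prime p, ~~ (p %| k.+2) & logn p (w (el z.1)) != logn p (w (el z.2))]}].
Proof.
move=> RP LP; pose N := (#|Q| * k.+2)%N.
have Q0 : (0 < #|Q|)%N by apply/card_gt0P; exists 1.
have N0 : (0 < N)%N by rewrite muln_gt0 Q0.
have oQ x : #[x] %| #|Q| by rewrite -cardsT; apply/order_dvdG; rewrite inE.
(* Strengthened for the induction: [M] is a common multiple of all orders so far, so a prime above
   it is new, and the primes avoid [#|Q|] too. *)
suff [w [M [rw lw Rw _ Lw]]] : exists (w : G -> nat) (M : nat),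
    [/\ realized w, same_letter_orders w, {in R, forall c, k.+2 %| w (el c)},
      (0 < M)%N /\ (forall g, w g %| M) &
      {in L, forall z, exists p, [/\ prime p, ~~ (p %| N)
        & logn p (w (el z.1)) != logn p (w (el z.2))]}].
  exists w; split=> // z zL; have [p [p_pr pN pz]] := Lw z zL; exists p; split=> //.
  by apply: contra pN => /dvdn_mull->.
elim: L LP => [|z L IHL] LP.
  have [w [rw lw wdvd wk]] := multiple_cover k.
  exists w, N; split=> // [c cR|]; first by have [] := RP c cR; apply: wk.
  by split=> // g; apply: dvdn_trans (wdvd g) _; apply: dvdn_mul.
have [|w [M [rw [lwA lwB] Rw [M0 wM] Lw]]] := IHL.
  by move=> y yL; apply: LP; rewrite inE yL orbT.
have [p p_gt p_pr] := prime_above (maxn M N).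
have [pM pN] : (M < p)%N /\ (N < p)%N by move: p_gt; rewrite gtn_max => /andP[].
have [z1R z2R z_ind] := LP z (mem_head _ _).
have [c0 pc] := RP _ z1R; have [d0 _] := RP _ z2R.
have Qp : (#|Q| <= p)%N by apply: leq_trans (ltnW pN); rewrite leq_pmulr.
have [v [rv [lvA lvB] vdvd vc vd]] := separating_cover p_pr Qp c0 d0 pc z_ind.
have p_ndvd m : (0 < m < p)%N -> ~~ (p %| m).
  by move=> /andP[m0 mp]; apply/negP=> /(dvdn_leq m0); rewrite leqNgt mp.
have logn_dvd0 r n m : n %| m -> ~~ (r %| m) -> logn r n = 0%N.
  move=> nm rm; rewrite lognE; case: ifP => // /and3P[_ _ rn].
  by case/negP: rm; apply: dvdn_trans nm.
have w0 g := realized_gt0 g rw; have v0 g := realized_gt0 g rv.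
have logn_wp g : logn p (w g) = 0%N.
  by apply: logn_dvd0 (wM g) _; rewrite p_ndvd ?M0.
have QN : #|Q| %| N by apply: dvdn_mulr.
have p_ndvd_q x : ~~ (p %| #[x]).
  apply/negP=> px; have := p_ndvd N; rewrite N0 pN => /(_ isT)/negP; apply.
  exact: dvdn_trans px (dvdn_trans (oQ x) QN).
exists (fun g => lcmn (w g) (v g)), (lcmn M (#|Q| * p ^ 2)); split.
- exact: realized_lcm.
- by split=> ?; rewrite ?lwA ?lwB ?lvA ?lvB; apply/lcmn_idPr.
- by move=> c cR; apply: dvdn_trans (Rw c cR) (dvdn_lcml _ _).
- split; first by rewrite lcmn_gt0 M0 muln_gt0 Q0 expn_gt0 prime_gt0.
  move=> g; rewrite dvdn_lcm (dvdn_trans (wM g)) ?dvdn_lcml //=.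
  apply: dvdn_trans (vdvd g) _; apply: dvdn_trans (dvdn_lcmr _ _).
  exact: dvdn_mul.
move=> y; rewrite inE => /predU1P[->|yL].
  exists p; split; rewrite ?p_ndvd ?N0 //.
  (* At [p] only the new cover counts, with valuation at least 2 at [z.1] and at most 1 at [z.2]. *)
  rewrite !logn_lcm // !logn_wp !max0n gtn_eqF //.
  have lt2 : (1 < logn p (v (el z.1)))%N by rewrite -pfactor_dvdn.
  apply: leq_ltn_trans lt2.
  apply: (@leq_trans (logn p (#[q (el z.2)] * p))).
    by apply: dvdn_leq_log vd; rewrite muln_gt0 order_gt0 prime_gt0.
  by rewrite lognM ?order_gt0 ?prime_gt0 // (logn_dvd0 _ _ _ (dvdnn _)) // logn_prime // eqxx.
have [r [r_pr rN wr]] := Lw y yL; exists r; split=> //.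
(* [p] divides none of the old orders, so it is not the earlier prime [r], at which the new cover
   contributes nothing. *)
have rp : r != p.
  by apply: contra wr => /eqP->; rewrite !logn_wp.
have logn_vr g : logn r (v g) = 0%N.
  apply: logn_dvd0 (vdvd g) _; apply/negP; rewrite Euclid_dvdM // => /orP[rq|].
    by case/negP: rN; apply: dvdn_trans rq (dvdn_trans (oQ _) QN).
  by rewrite Euclid_dvdX // dvdn_prime2 // (negbTE rp).
by rewrite !logn_lcm // !logn_vr !maxn0.
Qed.
End SeparatingCovers.

(** * Separation of conjugacy classes *)

Section Quotient.
Variables A B : groupType.
Local Notation G := (free_product A B).
Implicit Types (c d : seq (A * B)) (x y : A + B).

Definition dependence_commutators c d : seq G :=
  [seq [~ el c ^+ n, el d ^ g] | n <- iota 1 (size (prefixes d)), g <- prefixes d].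

Definition prefix_commutators c : seq G :=
  [seq [~ g, el c] | g <- behead (prefixes c)].

(** Finitely many commutators have to survive; they are nontrivial by [minimal_root_prefix] and
    [dependent_roots], and [L] collects their letters. If [R] is empty there are none, so the
    letters are left unconstrained. *)
Lemma residual_quotient (R : seq (seq (A * B))) :
  {in R, forall c, minimal_root c /\ c != [::]} ->
  exists L : seq (A + B), forall v w, realized v -> realized w ->
    (R != [::] -> {in L, forall x, ~~ letter1 x -> letter_order v w x != 1%N}) ->
  exists (Q : finGroupType) (q : UMagmaMorphism.type G Q),
    [/\ forall a, #[q (fp_inl B a)] = v a, forall b, #[q (fp_inr A b)] = w b,
        {in R, forall c, prefix_free q c}
      & {in R &, forall c d, ~ sim (el c) (el d) -> independent q c d}].
Proof.
move=> Rmin; pose Z : seq G := flatten [seq prefix_commutators c | c <- R] ++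
  flatten [seq dependence_commutators c d | c <- R, d <- R].
pose n := \max_(z <- Z) size (fp_word z).
exists (flatten [seq fp_word z | z <- Z]) => v w rv rw nontriv.
have [Q [q [qA qB q_neq1]]] := residually_finite_free_product n rv rw.
have qZ z : z \in Z -> z != 1 -> q z != 1.
  move=> zZ /eqP z1; apply/eqP; apply: q_neq1 => // [|x xz].
    exact: (@leq_bigmax_seq _ Z predT (fun z => size (fp_word z))).
  apply: nontriv.
  - by apply: contraTneq zZ => R0; rewrite /Z R0.
  - by apply/flatten_mapP; exists z.
  - have /andP[/allP w1 _] := fp_wordP z; exact: w1.
exists Q, q; split=> // [c cR g gc|c d cR dR ncd m /andP[m0 ms] g gd].
  apply: qZ; last exact: minimal_root_prefix (Rmin c cR).1 gc.
  rewrite mem_cat; apply/orP; left; apply/flatten_mapP; exists c => //.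
  exact: map_f.
have [minc c0] := Rmin c cR; have [mind d0] := Rmin d dR.
apply: qZ; last first.
  by apply/eqP=> /(dependent_roots minc mind c0 d0 gd m0)/ncd.
rewrite mem_cat; apply/orP; right; apply/flattenP.
exists (dependence_commutators c d); first exact: allpairs_f.
by apply: allpairs_f; rewrite // mem_iota m0 add1n ltnS.
Qed.

Definition representative (t : (A + B) + (seq (A * B) * nat)) : G :=
  match t with inl x => fp_letter x | inr z => el z.1 ^+ z.2 end.

Definition valid (t : (A + B) + (seq (A * B) * nat)) : Prop :=
  if t is inr z then [/\ minimal_root z.1, z.1 != [::] & (0 < z.2)%N] else True.

Lemma class_representative (g : G) : exists t, valid t /\ sim g (representative t).
Proof.
have [[x gx]|[c [k [min_c c0 k0 gc]]]] := conjugacy_classes g.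
  by exists (inl x).
by exists (inr (c, k)).
Qed.

Definition root_of (t : (A + B) + (seq (A * B) * nat)) :=
  if t is inr z then Some z.1 else None.

Lemma realized_root (w : G -> nat) g k : realized w -> k %| w g ->
  (w (g ^+ k) * k)%N = w g.
Proof.
by move=> [H [f fw]]; rewrite -!fw gmulfXn => k_dvd; rewrite orderXdiv ?divnK.
Qed.

(** Orders of roots are made so divisible that their powers exceed all letters in order. Powers of
    equivalent roots then differ by their exponents, and those of inequivalent roots by the
    valuation at a prime dividing no exponent. *)
Lemma separate_classes (I : finType) (t : I -> (A + B) + (seq (A * B) * nat)) :
  (forall i, valid (t i)) ->
  (forall i j, i != j -> ~ sim (representative (t i)) (representative (t j))) ->
  exists L : seq (A + B), forall v w, realized v -> realized w ->
    ((exists i, root_of (t i) <> None) ->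
      {in L, forall x, ~~ letter1 x -> letter_order v w x != 1%N}) ->
    (forall i j x y, i != j -> t i = inl x -> t j = inl y ->
      letter_order v w x <> letter_order v w y) ->
  exists2 u : G -> nat, realized u &
    forall i j, i != j -> u (representative (t i)) <> u (representative (t j)).
Proof.
move=> tV t_nsim; pose R := pmap (fun i => root_of (t i)) (enum I).
have RE i z : t i = inr z -> z.1 \in R.
  by move=> ti; rewrite mem_pmap; apply/mapP; exists i; rewrite ?mem_enum ?ti.
have [|L LP] := @residual_quotient R.
  move=> c; rewrite mem_pmap => /mapP[i _]; case ti: (t i) => [//|z] [->].
  by have := tV i; rewrite ti => -[].
exists L => v w rv rw Lnt vw.
have [|Q [q [qA qB q_pref q_ind]]] := LP v w rv rw.
  move=> R0; apply: Lnt; case RI: R R0 => [//|c R'] _.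
  have : c \in R by rewrite RI mem_head.
  by rewrite mem_pmap => /mapP[i _ ci]; exists i; rewrite -ci.
(* [N] bounds the orders of letters. A root whose order is a multiple of [N.+1] times its exponent
   still has order above [N] after raising to that exponent. *)
pose N := \max_(i : I) if t i is inl x then letter_order v w x else 0%N.
pose K := (N.+1 * \prod_(i : I) if t i is inr z then z.2 else 1)%N.
have K0 : (0 < K)%N.
  rewrite muln_gt0 /= prodn_gt0 // => i; have := tV i; by case: (t i) => [|z [_ _]].
pose S := [seq z <- [seq (c, d) | c <- R, d <- R] | `[< independent q z.1 z.2 >]].
(* The factor 2 brings the number into the form [k.+2]. *)
have KK : (K * 2).-2.+2 = (K * 2)%N by case: K K0 => // K' _; rewrite mulSn.
have [||u [ru [uA uB] uK uS]] := @separate_roots _ _ _ q (K * 2).-2 R S.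
- move=> c cR; split; last exact: q_pref.
  move: cR; rewrite mem_pmap => /mapP[i _]; case ti: (t i) => [//|z] [->].
  by have := tV i; rewrite ti => -[].
- move=> z; rewrite mem_filter => /andP[/asboolP z_ind /allpairsP[[c d] [/= cR dR zE]]].
  by move: z_ind; rewrite zE.
rewrite KK in uK uS; exists u => // i j ij.
have u_letter x : u (fp_letter x) = letter_order v w x.
  by case: x => [a|b] /=; [rewrite -qA -uA | rewrite -qB -uB].
have letterN k x : t k = inl x -> (letter_order v w x <= N)%N.
  move=> tk; have := leq_bigmax (F := fun i => if t i is inl x then letter_order v w x else 0%N) k.
  by rewrite tk.
have root_dvd k z : t k = inr z -> (N.+1 * z.2 %| K * 2)%N.
  by move=> tk; rewrite dvdn_mulr // dvdn_mul // (bigD1 k) //= tk dvdn_mulr.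
have u_root k z : t k = inr z -> (u (el z.1 ^+ z.2) * z.2)%N = u (el z.1).
  move=> tk; apply: realized_root => //.
  by apply: dvdn_trans (uK _ (RE _ _ tk)); apply: dvdn_trans (root_dvd _ _ tk); apply: dvdn_mull.
have rootN k z : t k = inr z -> (N < u (el z.1 ^+ z.2))%N.
  move=> tk; have z0 : (0 < z.2)%N by have := tV k; rewrite tk => -[].
  rewrite -(leq_pmul2r z0) (u_root _ _ tk) dvdn_leq ?realized_gt0 //.
  by apply: dvdn_trans (uK _ (RE _ _ tk)); apply: root_dvd tk.
have := t_nsim i j ij; have := vw i j.
case ti: (t i) => [x|z]; case tj: (t j) => [y|z'] vwij nsim /=.
- by rewrite !u_letter; apply: vwij.
- by rewrite u_letter => e; have := rootN _ _ tj; rewrite -e ltnNge (letterN i).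
- by rewrite u_letter => e; have := rootN _ _ ti; rewrite e ltnNge (letterN j).
move=> e; have := u_root _ _ ti; have := u_root _ _ tj; rewrite -e => uj ui.
have [z_sim|z_nsim] := pselect (sim (el z.1) (el z'.1)).
  have zz : z.2 = z'.2.
    apply/eqP; rewrite -(eqn_pmul2l (realized_gt0 (el z.1 ^+ z.2) ru)) ui uj.
    by rewrite (realized_sim ru z_sim).
  by apply: nsim; rewrite /= zz; apply: simX.
have [|p [p_pr pK]] := uS (z.1, z'.1).
  rewrite mem_filter; apply/andP; split.
    by apply/asboolP; apply: q_ind z_nsim; [apply: RE ti | apply: RE tj].
  by apply: allpairs_f; [apply: RE ti | apply: RE tj].
(* Passing from a root to its power does not change the valuation at [p]. *)
have logp k m : t k = inr m -> logn p m.2 = 0%N.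
  move=> tk; rewrite lognE; case: ifP => // /and3P[_ _ py]; case/negP: pK.
  by apply: dvdn_trans py (dvdn_trans (dvdn_mull _ (dvdnn _)) (root_dvd _ _ tk)).
have pos k m : t k = inr m -> (0 < m.2)%N.
  by move=> tk; have := tV k; rewrite tk => -[].
have ug := realized_gt0 (el z.1 ^+ z.2) ru.
rewrite /= -ui -uj !lognM ?(pos _ _ ti) ?(pos _ _ tj) //.
by rewrite (logp _ _ ti) (logp _ _ tj) eqxx.
Qed.

End Quotient.

(** * Separation of letters *)

Section Letters.
Variables A B : groupType.
Hypothesis sepA : forall n, (0 < n)%N -> order_separable n A.
Hypothesis sepB : forall n, (0 < n)%N -> order_separable n B.
Hypothesis orderAB : forall (a : A) (b : B), a <> 1 -> b <> 1 ->
     gorder a <> None -> gorder b <> None -> gorder a <> gorder b.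
Local Notation G := (free_product A B).
Implicit Types (x y z : A + B) (L : seq (A + B)).

Definition lsim x y := sim (fp_letter x) (fp_letter y).

Lemma nsim_inl a a' : ~ lsim (inl a) (inl a') -> ~ sim a a'.
Proof. by move=> naa /(sim_hom (@fp_inl A B)). Qed.

Lemma nsim_inr b b' : ~ lsim (inr b) (inr b') -> ~ sim b b'.
Proof. by move=> nbb /(sim_hom (@fp_inr A B)). Qed.

Lemma nsim_lr a b : ~ lsim (inl a) (inr b) -> a <> 1 \/ b <> 1.
Proof.
move=> nab; have [a1|] := pselect (a = 1); last by left.
right=> b1; apply: nab; rewrite a1 b1 /lsim -[fp_letter _]/(fp_inl B 1).
rewrite -[fp_letter (inr 1)]/(fp_inr A 1) !gmulf1; exact: sim_refl.
Qed.

Lemma nsim_rl a b : ~ lsim (inr b) (inl a) -> a <> 1 \/ b <> 1.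
Proof. by move=> nba; apply: nsim_lr => /sim_sym. Qed.

Definition lefts L := pmap (fun x => if x is inl a then Some a else None) L.
Definition rights L := pmap (fun x => if x is inr b then Some b else None) L.

Lemma nontrivial_letters L v w :
  (forall a, a \in lefts L -> a <> 1 -> v a <> 1%N) ->
  (forall b, b \in rights L -> b <> 1 -> w b <> 1%N) ->
  {in L, forall x, ~~ letter1 x -> letter_order v w x != 1%N}.
Proof.
move=> vL wL [a|b] xL /= /eqP x1; apply/eqP; [apply: vL|apply: wL] => //.
  by rewrite mem_pmap; apply/mapP; exists (inl a).
by rewrite mem_pmap; apply/mapP; exists (inr b).
Qed.

(** Meant for two letters next to a root, whose commutators require the letters of [L] to
    survive. *)
Lemma letter_pair x y L : exists v w, [/\ realized v, realized w,
  {in L, forall x, ~~ letter1 x -> letter_order v w x != 1%N}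
  & ~ lsim x y -> letter_order v w x <> letter_order v w y].
Proof.
have mixed a b : exists v w, [/\ realized v, realized w,
    {in L, forall x, ~~ letter1 x -> letter_order v w x != 1%N}
    & a <> 1 \/ b <> 1 -> v a <> w b].
  have [ab|nab] := pselect (a <> 1 \/ b <> 1).
    have [v [w [rv rw vL wL vw]]] :=
      separate_factors sepA sepB orderAB (lefts L) (rights L) ab.
    by exists v, w; split=> //; apply: nontrivial_letters.
  have [v rv vL] := residually_finite_seq sepA (lefts L).
  have [w rw wL] := residually_finite_seq sepB (rights L).
  by exists v, w; split=> //; apply: nontrivial_letters.
case: x y => [a|b] [a'|b'].
- have [v rv vL] := separate_seq sepA (1 :: a :: a' :: lefts L).
  have [w rw wL] := residually_finite_seq sepB (rights L).
  exists v, w; split=> //.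
    apply: nontrivial_letters => // c cL c1; rewrite -(realized_eq1 rv).
    by apply: vL; rewrite ?inE ?eqxx ?cL ?orbT // => /sim1.
  by move=> /nsim_inl; apply: vL; rewrite ?inE ?eqxx ?orbT.
- have [v [w [rv rw nt vw]]] := mixed a b'.
  by exists v, w; split=> // /nsim_lr/vw.
- have [v [w [rv rw nt vw]]] := mixed a' b.
  by exists v, w; split=> // /nsim_rl/vw h /esym.
have [v rv vL] := residually_finite_seq sepA (lefts L).
have [w rw wL] := separate_seq sepB (1 :: b :: b' :: rights L).
exists v, w; split=> //.
  apply: nontrivial_letters => // c cL c1; rewrite -(realized_eq1 rw).
  by apply: wL; rewrite ?inE ?eqxx ?cL ?orbT // => /sim1.
by move=> /nsim_inr; apply: wL; rewrite ?inE ?eqxx ?orbT.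
Qed.

(** Either all letters lie in one factor and the other factor is mapped trivially, or they split two
    to one. *)
Lemma letter_triple x y z : ~ lsim x y -> ~ lsim x z -> ~ lsim y z ->
  exists v w, [/\ realized v, realized w,
    letter_order v w x <> letter_order v w y,
    letter_order v w x <> letter_order v w z
    & letter_order v w y <> letter_order v w z].
Proof.
have orderBA (b : B) (a : A) : b <> 1 -> a <> 1 ->
    gorder b <> None -> gorder a <> None -> gorder b <> gorder a.
  by move=> b1 a1 gb ga /esym; apply: orderAB.
case: x y z => [a|b] [a'|b'] [a''|b''].
- move=> /nsim_inl h1 /nsim_inl h2 /nsim_inl h3.
  have [v rv vL] := separate_seq sepA [:: a; a'; a''].
  exists v, (fun=> 1%N); split=> //; first exact: realized1;
    by apply: vL; rewrite ?inE ?eqxx ?orbT.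
- move=> /nsim_inl h1 /nsim_lr h2 /nsim_lr h3.
  have [v [w [*]]] := separate_two_one sepA sepB orderAB h1 h2 h3.
  by exists v, w.
- move=> /nsim_lr h1 /nsim_inl h2 /nsim_rl h3.
  have [v [w [? ? ? h]]] := separate_two_one sepA sepB orderAB h2 h1 h3.
  by move=> h'; exists v, w; split=> // /esym.
- move=> /nsim_lr h1 /nsim_lr h2 /nsim_inr h3.
  have [||w [v [? ? ? h h']]] := @separate_two_one B A sepB sepA orderBA b' b'' a h3; try tauto.
  by exists v, w; split=> // /esym.
- move=> /nsim_rl h1 /nsim_rl h2 /nsim_inl h3.
  have [v [w [? ? ? h h']]] := separate_two_one sepA sepB orderAB h3 h1 h2.
  by exists v, w; split=> // /esym.
- move=> /nsim_rl h1 /nsim_inr h2 /nsim_lr h3.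
  have [||w [v [? ? ? h h']]] := @separate_two_one B A sepB sepA orderBA b b'' a' h2; try tauto.
  by exists v, w; split=> // /esym.
- move=> /nsim_inr h1 /nsim_rl h2 /nsim_rl h3.
  have [||w [v [? ? ? h h']]] := @separate_two_one B A sepB sepA orderBA b b' a'' h1; try tauto.
  by exists v, w; split.
move=> /nsim_inr h1 /nsim_inr h2 /nsim_inr h3.
have [w rw wL] := separate_seq sepB [:: b; b'; b''].
exists (fun=> 1%N), w; split=> //; first exact: realized1;
  by apply: wL; rewrite ?inE ?eqxx ?orbT.
Qed.

End Letters.

Theorem theorem3 (A B : groupType)
  (sepA : forall n : nat, (0 < n)%N -> order_separable n A)
  (sepB : forall n : nat, (0 < n)%N -> order_separable n B)
  (orderAB : forall (a : A) (b : B), a <> 1 -> b <> 1 ->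
     gorder a <> None -> gorder b <> None -> gorder a <> gorder b) :
  order_separable 3 (free_product A B).
Proof.
move=> u u_nsim; have [t tP] := choice (fun i => class_representative (u i)).
have tV i : valid (t i) := (tP i).1.
have ut i : sim (u i) (representative (t i)) := (tP i).2.
have t_nsim i j : i != j -> ~ sim (representative (t i)) (representative (t j)).
  move=> ij tij; have [nc nc'] := u_nsim i j ij.
  by have [/nc|/nc'] := sim_trans (ut i) (sim_trans tij (sim_sym (ut j))).
have [L LP] := separate_classes tV t_nsim.
have [v [w [rv rw nt vw]]] : exists v w, [/\ realized v, realized w,
    ((exists i, root_of (t i) <> None) ->
      {in L, forall x, ~~ letter1 x -> letter_order v w x != 1%N})
    & forall i j x y, i != j -> t i = inl x -> t j = inl y ->
      letter_order v w x <> letter_order v w y].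
  have ord3 (i : 'I_3) : [\/ i = ord0, i = inord 1 | i = inord 2].
    case: i => [[|[|[|//]]] lti]; [apply: Or31|apply: Or32|apply: Or33];
      by apply: val_inj; rewrite /= ?inordK.
  have nt01 : ord0 != inord 1 :> 'I_3 by rewrite -val_eqE /= inordK.
  have nt02 : ord0 != inord 2 :> 'I_3 by rewrite -val_eqE /= inordK.
  have nt12 : inord 1 != inord 2 :> 'I_3 by rewrite -val_eqE /= !inordK.
  (* If [t k] is a power of a root, at most two letters remain to be separated. *)
  have pair i j k : (forall l, [\/ l = i, l = j | l = k]) -> 
      (if t k is inr _ then True else False) -> exists v w, [/\ realized v, realized w,
    ((exists i, root_of (t i) <> None) ->
      {in L, forall x, ~~ letter1 x -> letter_order v w x != 1%N})
    & forall i j x y, i != j -> t i = inl x -> t j = inl y ->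
      letter_order v w x <> letter_order v w y].
    (* [inl 1] is a filler at powers of roots; the separation is used only when both entries are
       letters. *)
    move=> ijk tk; pose l m := if t m is inl x then x else inl 1.
    have [v [w [rv rw nt vw]]] := letter_pair sepA sepB orderAB (l i) (l j) L.
    exists v, w; split=> // m n x y mn tm tn.
    have nsim_xy : ~ lsim x y by have := t_nsim m n mn; rewrite tm tn.
    have := nsim_xy; have := fun h => nsim_xy (sim_sym h).
    case: (ijk m) (ijk n) => em [] en; subst m n; rewrite ?eqxx // in mn;
      rewrite ?tm ?tn // in tk; move: vw; rewrite /l tm tn => vw.
    - by move=> _ /vw.
    - by move=> /vw h _ /esym.
  case t0: (t ord0) => [x|z]; last first.
    apply: (pair (inord 1) (inord 2) ord0); rewrite ?t0 //.
    by move=> l; case: (ord3 l) => ->; [apply: Or33|apply: Or31|apply: Or32].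
  case t1: (t (inord 1)) => [y|z]; last first.
    apply: (pair ord0 (inord 2) (inord 1)); rewrite ?t1 //.
    by move=> l; case: (ord3 l) => ->; [apply: Or31|apply: Or33|apply: Or32].
  case t2: (t (inord 2)) => [z|z]; last first.
    by apply: (pair ord0 (inord 1) (inord 2)); rewrite ?t2.
  (* Three letters leave no root, so the condition on [L] holds vacuously. *)
  have [|||v [w [rv rw xy xz yz]]] := @letter_triple A B sepA sepB orderAB x y z.
  - by have := t_nsim _ _ nt01; rewrite t0 t1.
  - by have := t_nsim _ _ nt02; rewrite t0 t2.
  - by have := t_nsim _ _ nt12; rewrite t1 t2.
  exists v, w; split=> // [[i]|i j x' y' ij].
    by case: (ord3 i) => ->; rewrite ?t0 ?t1 ?t2.
  case: (ord3 i) (ord3 j) => ei [] ej; subst i j; rewrite ?eqxx // in ij;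
    by rewrite ?t0 ?t1 ?t2 => -[<-] [<-] //; apply/nesym.
have [o ro osep] := LP v w rv rw nt vw.
have [H [f [f_onto fo]]] := realized_onto ro; exists H, f; split=> // i j ij.
by rewrite !fo !(realized_sim ro (ut _)); apply: osep.
Qed.
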